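(* Let $M$ be a compact manifold and let $g:M\to M$ be a local diffeomorphism of class $C^2$. Suppose that $g$ is topologically conjugated to an expanding $C^1$ map $f$. If $g$ is non uniformly expanding on the set $\mathrm{Per}(g)$ of its periodic points, then $g$ is an expanding map.
   Context: Topologically conjugated: $f:N\to N$ is a map of a compact manifold $N$ and there is a homeomorphism $h:M\to N$ with $h\circ g=f\circ h$. Expanding map: a $C^1$ map $f$ of a compact Riemannian manifold is expanding if there are $c>0$ and $\sigma>1$ with $\|Df^n(x)v\|\ge c\,\sigma^n\|v\|$ for all points $x$, all tangent vectors $v$ at $x$ and all $n\in\mathbb{N}$. Non uniformly expanding (NUE): a $g$-invariant set $S\subset M$ is non uniformly expanding (equivalently, $g$ is non uniformly expanding on $S$) if there exist $\eta<0$ and a Riemannian metric on $M$ (an ''adapted'' metric) such that every $p\in S$ satisfies $$\liminf_{n\to+\infty}\frac1n\sum_{j=0}^{n-1}\log\|[Dg(g^j(p))]^{-1}\|\le\eta .$$ *)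

(* Defs.v *)
From HB Require Import structures.
From mathcomp Require Import all_boot all_order all_algebra.
From mathcomp Require Import all_classical all_reals all_analysis.

Set Implicit Arguments.
Unset Strict Implicit.
Unset Printing Implicit Defensive.

Import Order.TTheory GRing.Theory Num.Theory.
Import numFieldNormedType.Exports.

Local Open Scope classical_set_scope.
Local Open Scope ring_scope.

(* Only meant for open U: f is C^(k+1) on U iff it is differentiable on U and
   all its directional derivatives are C^k on U.  The domain being
   finite-dimensional, this is the usual notion of C^k function. *)
Fixpoint Ck_on (R : realType) (n : nat) (W : normedModType R) (k : nat)
    (U : set 'rV[R]_n) (f : 'rV[R]_n -> W) : Prop :=
  if k is k'.+1 then
    (forall x, U x -> differentiable f x) /\
    (forall v : 'rV[R]_n, Ck_on k' U (fun x => 'D_v f x))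
  else forall x, U x -> {for x, continuous f}.

Definition smooth_on (R : realType) (n : nat) (W : normedModType R)
    (U : set 'rV[R]_n) (f : 'rV[R]_n -> W) : Prop :=
  forall k, Ck_on k U f.

(* Smooth n-dimensional manifolds without boundary, given by a smooth atlas.
   Charts and their inverses are total functions, meaningful only on the chart
   domain and on the chart image respectively. *)
Record manifold (R : realType) (n : nat) := Manifold {
  carrier :> topologicalType;
  atlas : Type;
  dom : atlas -> set carrier;
  chart : atlas -> carrier -> 'rV[R]_n;
  inv_chart : atlas -> 'rV[R]_n -> carrier;
  manifold_hausdorff : hausdorff_space carrier;
  manifold_second_countable : @second_countable carrier;
  manifold_cover : forall x, exists i, dom i x;
  open_dom : forall i, open (dom i);
  open_chart_image : forall i, open (chart i @` dom i);
  chartK : forall i x, dom i x -> inv_chart i (chart i x) = x;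
  chart_continuous : forall i x, dom i x -> {for x, continuous (chart i)};
  inv_chart_continuous : forall i x, dom i x ->
        {for chart i x, continuous (inv_chart i)};
  transition_smooth : forall i j,
        smooth_on (chart i @` (dom i `&` dom j)) (chart j \o inv_chart i)
}.

(* A chosen chart around x: a tangent vector at x is represented by its
   coordinates, a row vector v : 'rV[R]_n, in the chart chart_at x. *)
Definition chart_at (R : realType) (n : nat) (M : manifold R n) (x : M) :
  atlas M := sval (cid (manifold_cover x)).

Section Maps.
Variables (R : realType) (m n : nat) (M : manifold R m) (N : manifold R n).
Implicit Type f : M -> N.

Definition local_expr f (i : atlas M) (j : atlas N) : 'rV[R]_m -> 'rV[R]_n :=
  chart j \o f \o inv_chart i.

(* Only meant for open A. *)
Definition Ck_map_on (k : nat) (A : set M) f : Prop :=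
  (forall x, A x -> {for x, continuous f}) /\
  (forall i j,
     Ck_on k (chart i @` (A `&` dom i `&` f @^-1` dom j)) (local_expr f i j)).

(* Row-vector convention: Df(x)v is v *m tangent_map f x. *)
Definition tangent_map f (x : M) : 'M[R]_(m, n) :=
  jacobian (local_expr f (chart_at x) (chart_at (f x))) (chart (chart_at x) x).

Definition homeomorphism f : Prop :=
  continuous f /\
  exists k : N -> M, [/\ continuous k, cancel f k & cancel k f].

End Maps.

Definition local_diffeomorphism (R : realType) (n : nat) (M : manifold R n)
    (k : nat) (g : M -> M) : Prop :=
  forall p : M, exists (U V : set M) (h : M -> M),
    [/\ open U /\ U p, open V, set_bij U V g &
        [/\ Ck_map_on k U g, Ck_map_on k V h &
            forall x, U x -> h (g x) = x]].

(* gram i x is the Gram matrix of the inner product on the tangent space at x,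
   in the coordinates of chart i; it is meaningful only for x in dom i. *)
Record riemannian_metric (R : realType) (n : nat) (M : manifold R n) :=
  RiemannianMetric {
  gram : atlas M -> M -> 'M[R]_n;
  gram_sym : forall i x, dom i x -> (gram i x)^T = gram i x;
  gram_pos : forall i x, dom i x ->
        forall v : 'rV[R]_n, v != 0 -> 0 < (v *m gram i x *m v^T) 0 0;
  gram_smooth : forall i, smooth_on (chart i @` dom i) (gram i \o inv_chart i);
  gram_compat : forall i j x, dom i x -> dom j x ->
        let J := jacobian (chart j \o inv_chart i) (chart i x) in
        gram i x = J *m gram j x *m J^T
}.

Section Dynamics.
Variables (R : realType) (n : nat) (M : manifold R n).
Implicit Types (G : riemannian_metric M) (g : M -> M).

Definition tangent_norm G (x : M) (v : 'rV[R]_n) : R :=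
  Num.sqrt ((v *m gram G (chart_at x) x *m v^T) 0 0).

Definition expanding G g : Prop :=
  Ck_map_on 1 setT g /\
  exists c s : R, [/\ 0 < c, 1 < s &
    forall (x : M) (v : 'rV[R]_n) (k : nat),
      c * s ^+ k * tangent_norm G x v <=
      tangent_norm G (iter k g x) (v *m tangent_map (iter k g) x)].

(* The operator norm of [Dg(x)]^-1, from the tangent space at g x to the one
   at x. *)
Definition norm_inv_tangent_map G g (x : M) : R :=
  sup [set tangent_norm G x (w *m invmx (tangent_map g x)) |
       w in [set w | tangent_norm G (g x) w <= 1]].

Definition nonuniformly_expanding g (S : set M) : Prop :=
  S `<=` g @^-1` S /\
  exists (eta : R) (G : riemannian_metric M), eta < 0 /\
    forall p, S p ->
      (limn_einf (fun k : nat =>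
         (k%:R^-1 *
          \sum_(0 <= j < k) ln (norm_inv_tangent_map G g (iter j g p)))%:E)
       <= eta%:E)%E.

Definition periodic_points g : set M :=
  [set p | exists k : nat, (0 < k)%N /\ iter k g p = p].

End Dynamics.

Definition topologically_conjugated (R : realType) (m n : nat)
    (M : manifold R m) (N : manifold R n) (g : M -> M) (f : N -> N) : Prop :=
  exists h : M -> N, homeomorphism h /\ h \o g = f \o h.

(* Main.v *)
(* The average of log |Dg^-1| along an orbit is a Birkhoff average of a function
   that is continuous on M, so only the topology of the dynamics matters for
   comparing a point with a periodic point shadowing it.  The expanding map f is
   positively expansive and g is a local homeomorphism conjugate to f; hence g
   satisfies a closing lemma: an orbit segment whose endpoints are close is
   shadowed by a periodic orbit of the same length, on which the average is at
   most eta < 0.  A finite cover by small sets splits an arbitrary orbit segment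
   into a bounded number of such almost closed segments, plus a bounded number of
   points.  All Birkhoff sums of length k are thus at most k eta/2 + C, which is
   uniform expansion for the adapted metric, and then for every metric by
   compactness. *)
Require Import Defs.
From mathcomp Require Import all_boot all_order all_algebra.
From mathcomp Require Import all_classical all_reals all_analysis.
From mathcomp Require Import zify lra ring.

Set Implicit Arguments.
Unset Strict Implicit.
Unset Printing Implicit Defensive.

Import Order.TTheory GRing.Theory Num.Theory.
Import numFieldNormedType.Exports.

Local Open Scope classical_set_scope.
Local Open Scope ring_scope.

(** * Closing lemma for expansive local homeomorphisms *)

(** No distance on [M] enters the closing argument. Closeness is membership in a neighbourhood of
    the diagonal, and its scale is a time: two points are close at level [N] when their orbits stay
    [E0]-close up to time [N]. Pulling back along [n] steps of an inverse branch gains [n] levels,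
    while the triangle inequality costs a fixed number [m] of them; hence only returns of length at
    least [m] are closed, and shorter ones are bounded crudely. On the differential side the
    obstacle is that [chart_at x] may jump with [x], so the matrix [tangent_map g x] need not vary
    continuously. Local estimates are therefore made in fixed charts, and changes of chart are
    treated as derivatives of the identity. Strict differentiability is the working notion because
    it composes and compares two moving points, which is what expansiveness of [f] requires. *)

Definition diag_nbhd (T : topologicalType) (E : set (T * T)) :=
  forall x : T, nbhs (x, x) E.

Lemma compact_seq_cover (T : topologicalType) (O : T -> set T) :
  compact [set: T] -> (forall x, nbhs x (O x)) ->
  exists s : seq T, forall x, exists2 a, a \in s & O a x.
Proof.
move=> /compact_near_coveringP cT nO.
(* Finite lists directed by inclusion: near covering along this filter says that every large enough
   list works, which is a finite subcover. *)
pose F := filter_from setT (fun s : seq T => [set t : seq T | {subset s <= t}]).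
have FF : Filter F.
  apply: filter_from_filter; first by exists [::].
  move=> s t _ _; exists (s ++ t) => // u sub.
  by split => x xs; apply: sub; rewrite mem_cat xs ?orbT.
have [|s _ sP] := cT _ F (fun t x => exists2 a, a \in t & O a x) FF.
  move=> x _; exists (O x, [set t : seq T | x \in t]) => /=.
    split; first exact: nO.
    by exists [:: x] => // t; apply; rewrite mem_head.
  by move=> [y t] /= [Oy xt]; exists x.
by exists s => x; apply: sP.
Qed.

(** The form of compactness used below. With [Q] empty it yields a point common to all the [C k];
    otherwise it turns a property holding near the intersection into one holding at a finite
    stage. *)
Lemma closed_decreasing_absorb (T : topologicalType) (C : nat -> set T)
    (Q : set T) :
  compact [set: T] -> (forall k, closed (C k)) ->
  (forall j k, (j <= k)%N -> C k `<=` C j) ->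
  (forall x, (forall k, C k x) -> nbhs x Q) ->
  exists k, C k `<=` Q.
Proof.
move=> /compact_near_coveringP cT Ccl Cdec CQ.
have [|k _ kP] := cT nat \oo (fun i x => C i x -> Q x) _.
  move=> x _; have [Cx|/existsNP[k nCx]] := pselect (forall k, C k x).
    have := CQ x Cx; exists (Q, setT) => /=; first by split=> //; exact: filterT.
    by move=> [y i] /= [Qy _] _.
  exists (~` C k, [set i | (k <= i)%N]) => /=.
    split; last by exists k.
    by apply: open_nbhs_nbhs; split => //; exact: closed_openC.
  by move=> [y i] /= [nCy ki] /(Cdec _ _ ki).
by exists k => x Cx; apply: (kP k _ x I Cx) => /=.
Qed.

Lemma closed_preimage (S T : topologicalType) (f : S -> T) (A : set T) :
  continuous f -> closed A -> closed (f @^-1` A).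
Proof. by move=> /continuous_closedP; apply. Qed.

Lemma closedX (S T : topologicalType) (A : set S) (B : set T) :
  closed A -> closed B -> closed (A `*` B).
Proof.
move=> clA clB; rewrite (_ : A `*` B = (fst @^-1` A) `&` (snd @^-1` B)) //.
by apply: closedI; apply: closed_preimage => // z; [exact: cvg_fst|exact: cvg_snd].
Qed.

(** By regularity each point has a closed neighbourhood whose square lies in [P]; a finite union of
    such squares is closed and symmetric. *)
Lemma closed_diag_nbhd (T : topologicalType) (P : set (T * T)) :
  compact [set: T] -> hausdorff_space T -> diag_nbhd P ->
  exists E, [/\ closed E, diag_nbhd E, (forall x y, E (x, y) -> E (y, x)) &
    E `<=` P].
Proof.
move=> cT hT dP.
have closed_sq : forall x : T, exists B : set T,
    [/\ nbhs x B, closed B & B `*` B `<=` P].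
  move=> x; have [[A B] /= [nA nB] ABP] := dP x.
  have [C nC CAB] := @compact_regular T x setT hT cT filterT (A `&` B)
    (filterI nA nB).
  exists (closure C); split; [|exact: closed_closure|].
    by apply: filterS nC; exact: subset_closure.
  by move=> [a b] /= [/CAB[Aa _] /CAB[_ Bb]]; apply: ABP.
have [B BP] := choice closed_sq.
have [s sP] : exists s : seq T, forall x, exists2 a, a \in s & (B a)° x.
  apply: compact_seq_cover => // x; apply/nbhs_interior.
  by have [] := BP x.
exists (\bigcup_(a in [set` s]) (B a `*` B a)); split.
- rewrite bigcup_seq; apply: closed_bigsetU => a _.
  by have [_ clO _] := BP a; exact: closedX.
- move=> x; have [a a_s Oax] := sP x.
  exists (B a, B a) => //= z Oz; by exists a.
- by move=> x y [a a_s [/= Ox Oy]]; exists a.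
- by move=> z [a _ Oz]; have [_ _] := BP a; apply.
Qed.

Section Closing.
Variables (T : topologicalType) (g : T -> T) (E0 : set (T * T)).
Hypotheses (cT : compact [set: T]) (gc : continuous g).
Hypothesis gopen : forall x O, nbhs x O -> nbhs (g x) (g @` O).
Hypotheses (E0cl : closed E0) (E0n : diag_nbhd E0).
Hypothesis E0sym : forall x y, E0 (x, y) -> E0 (y, x).
Hypothesis expansive :
  forall x y, (forall k, E0 (iter k g x, iter k g y)) -> x = y.

(** The Bowen neighbourhood of level [N]; it involves the [N.+1] times from 0 to [N], and a larger
    [N] is a finer scale. *)
Definition bowen_nbhd N : set (T * T) :=
  [set z | forall j, (j <= N)%N -> E0 (iter j g z.1, iter j g z.2)].
Local Notation E := bowen_nbhd.

Lemma E0_refl x : E0 (x, x).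
Proof. exact: nbhs_singleton (E0n x). Qed.

Lemma bowen_refl N x : E N (x, x).
Proof. by move=> j _; exact: E0_refl. Qed.

Lemma bowen_sym N x y : E N (x, y) -> E N (y, x).
Proof. by move=> Exy j /Exy; exact: E0sym. Qed.

Lemma bowen_dec j k : (j <= k)%N -> E k `<=` E j.
Proof. by move=> jk z Ez i ij; apply: Ez; exact: leq_trans jk. Qed.

Lemma bowen_iter N j x y : E (N + j) (x, y) -> E N (iter j g x, iter j g y).
Proof.
by move=> Exy i iN /=; rewrite -!iterD; apply: Exy; rewrite leq_add2r.
Qed.

Lemma iter_continuous j : continuous (iter j g).
Proof.
elim: j => [|j IH] x; first exact: cvg_id.
by apply: (@continuous_comp _ _ _ (iter j g) g); [exact: IH|exact: gc].
Qed.

Lemma bowen_closed N : closed (E N).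
Proof.
rewrite (_ : E N = \bigcap_(j in [set j | (j <= N)%N])
    ((fun z : T * T => (iter j g z.1, iter j g z.2)) @^-1` E0)); last first.
  by apply/seteqP; split => z Ez j /= jN; apply: Ez.
apply: closed_bigI => j _; apply: closed_preimage => // z; apply: cvg_pair => /=.
  by apply: (@continuous_comp _ _ _ fst (iter j g)); [exact: cvg_fst|exact: iter_continuous].
by apply: (@continuous_comp _ _ _ snd (iter j g)); [exact: cvg_snd|exact: iter_continuous].
Qed.

Lemma bowen_eq x y : (forall N, E N (x, y)) -> x = y.
Proof. by move=> Exy; apply: expansive => k; exact: (Exy k k). Qed.

Lemma bowen_nbhd_diag N : diag_nbhd (E N).
Proof.
move=> x; have c j : continuous (fun z : T * T => (iter j g z.1, iter j g z.2)).
  move=> z; apply: cvg_pair => /=.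
    by apply: (@continuous_comp _ _ _ fst (iter j g)); [exact: cvg_fst|exact: iter_continuous].
  by apply: (@continuous_comp _ _ _ snd (iter j g)); [exact: cvg_snd|exact: iter_continuous].
have EN := @filter_forall _ 'I_N.+1
  (fun j => (fun z : T * T => (iter j g z.1, iter j g z.2)) @^-1` E0) (nbhs (x, x))
  (nbhs_filter (x, x)) (fun j => c j (x, x) E0 (E0n _)).
apply: filterS EN => z zP j jN; exact: (zP (Ordinal (jN : (j < N.+1)%N))).
Qed.

Lemma compactTX : compact [set: T * T].
Proof. by rewrite -setXTT; exact: compact_setX. Qed.

(** Expansiveness says that these decreasing closed sets intersect in the diagonal. *)
Lemma bowen_small (P : set (T * T)) : diag_nbhd P -> exists N, E N `<=` P.
Proof.
move=> dP; apply: closed_decreasing_absorb.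
- exact: compactTX.
- exact: bowen_closed.
- exact: bowen_dec.
- by move=> [x y] /bowen_eq ->.
Qed.

(** The closed sets [E N (g x, y)] shrink to the graph of [g], and near a point [(x, g x)] of the
    graph the openness of [g] supplies a preimage of [y] close to [x]. *)
Lemma bowen_branch0 :
  exists N0, forall x y, E N0 (g x, y) -> exists2 y', g y' = y & E0 (x, y').
Proof.
have gidc : continuous (fun z : T * T => (g z.1, z.2)).
  move=> z; apply: cvg_pair => /=; last exact: cvg_snd.
  by apply: (@continuous_comp _ _ _ fst g); [exact: cvg_fst|exact: gc].
have [N NP] : exists N, (fun z : T * T => (g z.1, z.2)) @^-1` (E N) `<=`
    [set z | exists2 y', g y' = z.2 & E0 (z.1, y')].
  apply: closed_decreasing_absorb.
  - exact: compactTX.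
  - by move=> k; apply: closed_preimage => //; exact: bowen_closed.
  - by move=> j k jk z; exact: bowen_dec.
  move=> [x y] /= /bowen_eq <- {y}.
  have [[A B] /= [nA nB] ABE] := E0n x.
  exists (A, g @` B) => /=; first by split => //; exact: gopen.
  by move=> [a _] /= [Aa [b Bb <-]]; exists b => //; exact: (ABE (a, b)).
by exists N => x y Exy; exact: (NP (x, y)).
Qed.

(** Each backward step prepends one [E0]-close time, so the level rises by one per preimage; this
    replaces contraction of the inverse branches. One threshold [N0] serves for all [n] because the
    level never falls. *)
Lemma bowen_branch :
  exists N0, forall N n x y, (N0 <= N)%N -> E N (iter n g x, y) ->
    exists2 y', iter n g y' = y & E (N + n) (x, y').
Proof.
have [N0 N0P] := bowen_branch0; exists N0 => N n x y N0N.
elim: n x => [|n IH] x; first by rewrite addn0; exists y.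
rewrite iterSr => /IH [y1 y1y Ey1].
have [y' y'y1 Ey'] : exists2 y', g y' = y1 & E0 (x, y').
  by apply: N0P; apply: bowen_dec Ey1; rewrite ltnW // ltnS leq_addr || lia.
exists y'; first by rewrite iterSr y'y1.
move=> [|j] jN //=; rewrite -!iterS !iterSr /= y'y1.
by apply: Ey1 => /=; lia.
Qed.

(** The loss [m] must not depend on [N]. Compactness gives it at level [N0]; a time [j > N0] is then
    reached by applying level [N0] to the orbits shifted by [j - N0]. *)
Lemma bowen_trans N0 : exists m, forall N x y z, (N0 <= N)%N ->
  E (N + m) (x, y) -> E (N + m) (y, z) -> E N (x, z).
Proof.
pose C k : set (T * (T * T)) := [set w | E k (w.1, w.2.1) /\ E k (w.2.1, w.2.2)].
have cT3 : compact [set: T * (T * T)].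
  by rewrite -setXTT; apply: compact_setX => //; exact: compactTX.
have c1 : continuous (fun w : T * (T * T) => (w.1, w.2.1)).
  move=> w; apply: cvg_pair => /=; first exact: cvg_fst.
  by apply: (@continuous_comp _ _ _ snd fst); [exact: cvg_snd|exact: cvg_fst].
have c2 : continuous (fun w : T * (T * T) => (w.2.1, w.2.2)).
  move=> w; apply: cvg_pair => /=.
    by apply: (@continuous_comp _ _ _ snd fst); [exact: cvg_snd|exact: cvg_fst].
  by apply: (@continuous_comp _ _ _ snd snd); [exact: cvg_snd|exact: cvg_snd].
have c3 : continuous (fun w : T * (T * T) => (w.1, w.2.2)).
  move=> w; apply: cvg_pair => /=; first exact: cvg_fst.
  by apply: (@continuous_comp _ _ _ snd snd); [exact: cvg_snd|exact: cvg_snd].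
have [k kP] : exists k, C k `<=` [set w | E N0 (w.1, w.2.2)].
  apply: closed_decreasing_absorb.
  - exact: cT3.
  - by move=> k; apply: closedI; apply: closed_preimage => //; exact: bowen_closed.
  - by move=> i j ij w [] /(bowen_dec ij) ? /(bowen_dec ij).
  - move=> [x [y z]] /= Cw.
    have xy : x = y by apply: bowen_eq => k; have [] := Cw k.
    have yz : y = z by apply: bowen_eq => k; have [] := Cw k.
    rewrite -yz -xy.
    exact: (c3 (x, (x, x)) (E N0) (@bowen_nbhd_diag N0 x)).
exists k => N x y z N0N Exy Eyz j jN.
have [jN0|N0j] := leqP j N0.
  apply: (kP (x, (y, z))) => //=; split.
    by apply: bowen_dec Exy; lia.
  by apply: bowen_dec Eyz; lia.
have [i [iN j0 jE]] : exists i, [/\ (i + N0 <= N)%N, (j - i <= N0)%N & (i <= j)%N].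
  by exists (j - N0)%N; split; lia.
suff /(_ (j - i)%N j0) : E N0 (iter i g x, iter i g z).
  by rewrite /= -!iterD subnK.
apply: (kP (iter i g x, (iter i g y, iter i g z))); split => /=.
  by apply: bowen_iter; apply: bowen_dec Exy; lia.
by apply: bowen_iter; apply: bowen_dec Eyz; lia.
Qed.

(* Nested closed sets replace the usual iteration of the contracting inverse
   branch: the points whose [g^n]-orbit stays near [x] for all times have, by
   expansiveness, the same orbit as their image under [g^n]. *)
Lemma closing (P : set (T * T)) : diag_nbhd P ->
  exists (D : set (T * T)) m, diag_nbhd D /\
    forall n x, (m <= n)%N -> D (x, iter n g x) ->
      exists2 p, iter n g p = p &
        forall j, (j < n)%N -> P (iter j g x, iter j g p).
Proof.
move=> /bowen_small [NP NPP].
have [N0 branch] := bowen_branch.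
have [m trans] := bowen_trans N0.
(* [NP] gives [P], [N0] allows branches and the triangle inequality, and [m] makes the level
   [N + n - m] still cover all times below [n]. *)
pose N := (NP + N0 + m)%N.
exists (E (N + m)), m; split; first exact: bowen_nbhd_diag.
move=> n x mn /bowen_sym Dx.
pose C k := [set y | forall i, (i <= k)%N -> E (N + n) (x, iter (i * n) g y)].
have Cne k : C k !=set0.
  elim: k => [|k [y Cy]].
    by exists x => i; rewrite leqn0 => /eqP ->; exact: bowen_refl.
  have [y' y'y Ey'] : exists2 y', iter n g y' = y & E (N + n) (x, y').
    apply: branch; first by rewrite /N; lia.
    (* Since [m <= n], the level [N + n] built into [C k] pays for the [m] levels lost here. *)
    apply: (trans _ _ x); [by rewrite /N; lia|exact: Dx|].
    by apply: bowen_dec (Cy 0 isT); lia.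
  exists y' => -[_ //|i] ik; rewrite mulSnr iterD y'y.
  exact: Cy.
have [p Cp] : exists p, forall k, C k p.
  apply: contrapT => nC.
  have [k Ck] : exists k, C k `<=` set0.
    apply: closed_decreasing_absorb => //.
    - move=> k; rewrite (_ : C k = \bigcap_(i in [set i | (i <= k)%N])
          ((fun y => (x, iter (i * n) g y)) @^-1` E (N + n))) //.
      apply: closed_bigI => i _; apply: closed_preimage; last exact: bowen_closed.
      move=> y; apply: cvg_pair => /=; first exact: cvg_cst.
      exact: iter_continuous.
    - by move=> j k jk y Cy i ij; apply: Cy; exact: leq_trans jk.
    - by move=> y Cy; exfalso; apply: nC; exists y.
  by have [y /Ck] := Cne k.
have Ep i : E (N + n) (x, iter (i * n) g p) by exact: (Cp i).
exists p; last first.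
  move=> j jn; apply: NPP; apply: bowen_iter.
  by apply: bowen_dec (Ep 0); rewrite /N; lia.
apply/esym/expansive => k.
have [n0|n0] := posnP n.
  by rewrite n0 /=; exact: E0_refl.
(* Write [k] as [q] turns plus [r < n]: the iterates of [p] at times [q * n] and [q.+1 * n] are both
   close to [x], hence close to each other for the next [r] steps. *)
rewrite (divn_eq k n) addnC; have := ltn_pmod k n0.
move: (k %% n)%N (k %/ n)%N => r q rn.
rewrite -iterD -addnA -mulSnr !(iterD r).
have Eq : E (N + n - m) (iter (q * n) g p, iter (q.+1 * n) g p).
  apply: (trans _ _ x); first by rewrite /N; lia.
    by apply: bowen_sym; apply: bowen_dec (Ep _); lia.
  by apply: bowen_dec (Ep _); lia.
by apply: (Eq r); rewrite /N; lia.
Qed.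

End Closing.

(** * Birkhoff sums along a finitely coloured orbit *)

Section Coloring.
Variables (R : realDomainType) (K : finType) (c : nat -> K) (a : nat -> R).
Variables (B : R) (B0 : 0 <= B).
Hypothesis a_le : forall i, a i <= B.
Hypothesis return_le : forall i j, (i <= j)%N -> c i = c j ->
  \sum_(i <= t < j) a t <= B.

(* Cut a segment at the last visit to the colour of its first term: the part
   after the cut avoids that colour. *)
Lemma sum_le_colors (s : nat) i n : (i <= n)%N ->
  (#|[pred k | [exists t : 'I_n, (i <= t)%N && (c t == k)]]| <= s)%N ->
  \sum_(i <= t < n) a t <= s%:R * (B + B).
Proof.
have [m] := ubnP (n - i)%N; elim: s i m => [|s IH] i m mi ile.
  rewrite leqn0 => /eqP/card0_eq cs0.
  have -> : i = n.
    apply/eqP; rewrite eqn_leq ile leqNgt; apply/negP => iltn.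
    have /negbT/existsP[] := cs0 (c i).
    by exists (Ordinal iltn); rewrite leqnn eqxx.
  by rewrite big_geq // mul0r.
move=> cs; have [->|iltn] := eqVneq i n.
  by rewrite big_geq // mulr_ge0 ?ler0n ?addr_ge0.
have {}iltn : (i < n)%N by rewrite ltn_neqAle iltn.
pose Q t := (i <= t < n)%N && (c t == c i).
have exQ : exists t, Q t by exists i; rewrite /Q leqnn iltn eqxx.
have Qb t : Q t -> (t <= n)%N by move=> /andP[/andP[_ /ltnW]].
have [j /andP[/andP[ij jn] /eqP cj] jmax] := ex_maxnP exQ Qb.
(* Each colour costs one [B] for the return from [i] to [j] and one for the term at [j] itself. *)
rewrite (@big_cat_nat _ _ _ j) //=; last exact: ltnW.
rewrite (@big_cat_nat _ _ _ j.+1 j) //= big_nat1.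
have sj := return_le ij (esym cj).
have srest : \sum_(j.+1 <= t < n) a t <= s%:R * (B + B).
  apply: (IH _ m) => //; first by lia.
  rewrite -ltnS; apply: leq_trans cs; apply: proper_card.
  apply/fintype.properP; split.
    apply/fintype.subsetP => k; rewrite !inE => /existsP[t /andP[jt ct]].
    by apply/existsP; exists t; rewrite ct andbT; lia.
  exists (c i); rewrite inE.
    by apply/existsP; exists (Ordinal iltn); rewrite leqnn eqxx.
  apply/existsP => -[t /andP[jt ct]].
  by have := jmax t; rewrite /Q ltn_ord ct; lia.
have := a_le j; rewrite -natr1; move: sj srest; nra.
Qed.

Lemma sum_le_card n : \sum_(0 <= t < n) a t <= #|K|%:R * (B + B).
Proof. by apply: sum_le_colors => //; exact: max_card. Qed.

End Coloring.

Lemma diag_nbhd_seq_cover (T : topologicalType) (D : set (T * T)) :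
  compact [set: T] -> diag_nbhd D ->
  exists (s : seq T) (B : T -> set T),
    (forall a, B a a) /\ (forall a, B a `*` B a `<=` D) /\
    forall x, exists2 a, a \in s & B a x.
Proof.
move=> cT dD.
have sq (x : T) : exists B : set T, nbhs x B /\ B `*` B `<=` D.
  have [[A B] /= [nA nB] ABD] := dD x.
  exists (A `&` B); split; first exact: filterI.
  by move=> [a b] [/= [Aa _] [_ Bb]]; exact: ABD.
have [B BP] := choice sq.
have [s sP] := compact_seq_cover cT (fun x => (BP x).1).
exists s, B; split; first by move=> a; exact: nbhs_singleton (BP a).1.
by split => // a; exact: (BP a).2.
Qed.

(** The colours index squares contained in [D], so two visits to one colour delimit a segment that
    [closing] can close if it is long. On the segment [phi] exceeds its value on the periodic orbit
    by at most [e] per step, so the excess of [phi] over [eta + e] sums to at most 0. *)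
Lemma birkhoff_sum_bound (R : realFieldType) (T : topologicalType) (g : T -> T)
    (E0 : set (T * T)) (phi : T -> R) (eta e : R) :
  compact [set: T] -> continuous g ->
  (forall x O, nbhs x O -> nbhs (g x) (g @` O)) ->
  closed E0 -> diag_nbhd E0 -> (forall x y, E0 (x, y) -> E0 (y, x)) ->
  (forall x y, (forall k, E0 (iter k g x, iter k g y)) -> x = y) ->
  (forall d, 0 < d -> diag_nbhd [set z | phi z.1 <= phi z.2 + d]) ->
  (forall k p, (0 < k)%N -> iter k g p = p ->
     \sum_(0 <= j < k) phi (iter j g p) <= eta *+ k) ->
  0 < e ->
  exists C, forall n x,
    \sum_(0 <= j < n) phi (iter j g x) <= (eta + e) *+ n + C.
Proof.
move=> cT gc gopen E0cl E0n E0sym expansive phic phiper e0.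
have [D [m [dD closeD]]] :=
  closing cT gc gopen E0cl E0n E0sym expansive (phic _ e0).
have [s [B [_ [BD sB]]]] := diag_nbhd_seq_cover cT dD.
have [s' [B' [B'r [B'P s'B']]]] := diag_nbhd_seq_cover cT (phic _ e0).
(* An upper bound for the excess: every point shares a square with some [a] in [s'], where [phi]
   differs by at most [e]. The sum stands in for a maximum. *)
pose B1 := \sum_(a <- s') `|phi a + e - (eta + e)|.
have B10 : 0 <= B1 by apply: sumr_ge0 => a _.
have phiB1 x : phi x - (eta + e) <= B1.
  have [a a_s Bx] := s'B' x.
  have /= phixa := B'P a (x, a) (conj Bx (B'r a)).
  apply: le_trans (_ : `|phi a + e - (eta + e)| <= _).
    by apply: le_trans (ler_norm _); lra.
  by rewrite /B1 (big_rem a) //= lerDl; apply: sumr_ge0 => b _.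
have /choice[col colP] : forall x, exists i : 'I_(size s), B (nth x s i) x /\ nth x s i \in s.
  move=> x; have [a a_s Bx] := sB x.
  have ia : (index a s < size s)%N by rewrite index_mem.
  by exists (Ordinal ia); rewrite /= nth_index.
(* [B1 *+ m.+1] dominates returns of fewer than [m] terms and, thanks to the extra summand, a single
   term even when [m = 0]. *)
exists (#|'I_(size s)|%:R * (B1 *+ m.+1 + B1 *+ m.+1)) => n x.
have B10' : 0 <= B1 *+ m.+1 by exact: mulrn_wge0.
have := @sum_le_card R 'I_(size s) (fun i => col (iter i g x))
  (fun i => phi (iter i g x) - (eta + e)) (B1 *+ m.+1) B10' _ _ n.
rewrite big_split /= sumrN big_const_nat subn0 iter_addr_0 lerBlDl; apply.
  by move=> i; apply: le_trans (phiB1 _) _; rewrite mulrS lerDl mulrn_wge0.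
move=> i j ij cij.
have -> : \sum_(i <= t < j) (phi (iter t g x) - (eta + e)) =
    \sum_(0 <= t < j - i) (phi (iter t g (iter i g x)) - (eta + e)).
  rewrite -{1}(add0n i) -{1}(subnK ij) big_addn addnK.
  by apply: eq_bigr => t _; rewrite -iterD.
have [jim|mji] := ltnP (j - i)%N m.
  apply: le_trans (_ : \sum_(0 <= t < j - i) B1 <= _).
    by apply: ler_sum => t _; exact: phiB1.
  rewrite big_const_nat subn0 iter_addr_0.
  by apply: ler_wpMn2l => //; lia.
have [ji0|ji0] := posnP (j - i)%N; first by rewrite ji0 big_geq.
have [|p pp pP] := closeD (j - i)%N (iter i g x) mji.
  rewrite -iterD subnK //.
  have [Bi is_] := colP (iter i g x); have [Bj _] := colP (iter j g x).
  apply: (BD (nth (iter i g x) s (col (iter i g x)))); split => //=.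
  by rewrite cij (set_nth_default (iter j g x)).
apply: le_trans (_ : 0 <= _) => //.
apply: le_trans (_ : \sum_(0 <= t < j - i) (phi (iter t g p) - eta) <= _).
  rewrite big_nat [leRHS]big_nat; apply: ler_sum => t /andP[_ tj].
  by have /= := pP t tj; lra.
rewrite big_split /= sumrN big_const_nat subn0 iter_addr_0 subr_le0.
exact: phiper.
Qed.

(** * Matrices, quadratic forms and strict differentiability *)

Section MatrixNorm.
Variable R : realType.

Lemma mx_norm_le m n (A : 'M[R]_(m, n)) e :
  0 <= e -> (forall i j, `|A i j| <= e) -> `|A| <= e.
Proof.
move=> e0 Ae; rewrite /Num.Def.normr /= mx_normrE.
by apply: bigmax_le => // -[i j] _ /=; exact: Ae.
Qed.

Lemma mx_coord_le m n (A : 'M[R]_(m, n)) i j : `|A i j| <= `|A|.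
Proof.
rewrite [leRHS]/Num.Def.normr /= mx_normrE.
exact: (le_bigmax _ (fun ij => `|A ij.1 ij.2|) (i, j)).
Qed.

Lemma mx_norm_mul m n p (B : 'M[R]_(p, m)) (A : 'M[R]_(m, n)) :
  `|B *m A| <= m%:R * `|A| * `|B|.
Proof.
apply: mx_norm_le => [|i j]; first by rewrite !mulr_ge0.
rewrite mxE; apply: le_trans (ler_norm_sum _ _ _) _.
apply: le_trans (_ : \sum_(k < m) `|A| * `|B| <= _).
  apply: ler_sum => k _; rewrite normrM mulrC.
  by apply: ler_pM => //; exact: mx_coord_le.
by rewrite sumr_const card_ord -mulrA mulr_natl.
Qed.

Lemma mx_norm_tr m n (A : 'M[R]_(m, n)) : `|A^T| <= `|A|.
Proof. by apply: mx_norm_le => // i j; rewrite mxE mx_coord_le. Qed.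

Definition quad n (P : 'M[R]_n) (v : 'rV[R]_n) : R := (v *m P *m v^T) 0 0.

Lemma quadB n (P Q : 'M[R]_n) v : quad (P - Q) v = quad P v - quad Q v.
Proof. by rewrite /quad mulmxBr mulmxBl !mxE. Qed.

Lemma quadZ n (P : 'M[R]_n) a v : quad P (a *: v) = a ^+ 2 * quad P v.
Proof. by rewrite /quad linearZ /= -!scalemxAl -scalemxAr scalerA !mxE expr2. Qed.

Lemma quad0 n (P : 'M[R]_n) : quad P 0 = 0.
Proof. by rewrite /quad !mul0mx mxE. Qed.

Lemma quad_conj m n (A : 'M[R]_(m, n)) P v : quad (A *m P *m A^T) v = quad P (v *m A).
Proof. by rewrite /quad trmx_mul !mulmxA. Qed.

Lemma quad_norm n (P : 'M[R]_n) v : `|quad P v| <= n%:R ^+ 2 * `|P| * `|v| ^+ 2.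
Proof.
apply: le_trans (mx_coord_le _ _ _) _; apply: le_trans (mx_norm_mul _ _) _.
have := mx_norm_mul v P; have := mx_norm_tr v.
have : 0 <= n%:R :> R by [].
have := normr_ge0 (v *m P); have := normr_ge0 v; have := normr_ge0 (v^T).
have := normr_ge0 P.
move: `|P| `|v^T| `|v| `|v *m P| n%:R => p t u w N p0 t0 u0 w0 N0 tu wN.
have -> : N ^+ 2 * p * u ^+ 2 = (N * u) * (N * p * u) by ring.
by apply: ler_pM => //; [rewrite mulr_ge0|rewrite ler_wpM2l].
Qed.

Lemma cvg_mx T (F : set_system T) {FF : Filter F} m n (f : T -> 'M[R]_(m, n)) (A : 'M[R]_(m, n)) :
  (forall i j, f x i j @[x --> F] --> A i j) -> f @ F --> A.
Proof.
move=> fA; apply/cvgrPdist_le => e e0.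
have : \forall x \near F, forall ij : 'I_m * 'I_n, `|A ij.1 ij.2 - f x ij.1 ij.2| <= e.
  by apply: filter_forall => -[i j] /=; exact: (cvgrPdist_le _ _).1 (fA i j) e e0.
apply: filterS => x Ax; apply: mx_norm_le => [|i j]; first exact: ltW.
by rewrite !mxE; exact: (Ax (i, j)).
Qed.

Lemma cvg_coord T (F : set_system T) {FF : Filter F} m n
  (f : T -> 'M[R]_(m, n)) (A : 'M[R]_(m, n)) i j :
  f @ F --> A -> f x i j @[x --> F] --> A i j.
Proof. by move=> fA; exact: (cvg_comp _ _ fA (@coord_continuous _ _ _ i j A)). Qed.

Lemma cvg_mulmx T (F : set_system T) {FF : Filter F} m n p
  (f : T -> 'M[R]_(m, n)) (h : T -> 'M[R]_(n, p))
  (A : 'M[R]_(m, n)) (B : 'M[R]_(n, p)) :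
  f @ F --> A -> h @ F --> B -> f x *m h x @[x --> F] --> A *m B.
Proof.
move=> fA hB; apply: cvg_mx => i j.
under eq_fun do rewrite mxE; rewrite mxE.
apply: cvg_big => [|k _]; first exact: add_continuous.
by apply: cvgM; exact: cvg_coord.
Qed.

Lemma cvg_trmx T (F : set_system T) {FF : Filter F} m n
  (f : T -> 'M[R]_(m, n)) (A : 'M[R]_(m, n)) : f @ F --> A -> (f x)^T @[x --> F] --> A^T.
Proof.
move=> fA; apply: cvg_mx => i j; under eq_fun do rewrite mxE; rewrite mxE.
exact: cvg_coord.
Qed.

Lemma quad_continuous n (P : 'M[R]_n) : continuous (quad P).
Proof.
have qc (v : 'rV[R]_n) : quad P w @[w --> v] --> quad P v.
  apply: (@cvg_coord _ (nbhs v) _ _ _ (fun w : 'rV[R]_n => w *m P *m w^T)).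
  apply: (@cvg_mulmx _ (nbhs v) _ _ _ _ (fun w : 'rV[R]_n => w *m P) trmx).
    by apply: (@cvg_mulmx _ (nbhs v) _ _ _ _ id (fun=> P)); [exact: cvg_id|exact: cvg_cst].
  by apply: (@cvg_trmx _ (nbhs v) _ _ _ id); exact: cvg_id.
exact: qc.
Qed.

Definition posdef n (P : 'M[R]_n) := forall v, v != 0 -> 0 < quad P v.

Lemma posdef_lower n (P : 'M[R]_n) : posdef P ->
  exists2 c, 0 < c & forall v, c * `|v| ^+ 2 <= quad P v.
Proof.
move=> Ppos; pose S := [set v : 'rV[R]_n | `|v| = 1].
have scale v : v != 0 -> S (`|v|^-1 *: v).
  by move=> v0; rewrite /S /= normrZ normfV normr_id mulVf // normr_eq0.
(* The unit sphere is empty only in dimension 0, where any constant will do. *)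
have [S0|S0] := eqVneq S set0.
  exists 1 => // v; have [->|/scale] := eqVneq v 0; last by rewrite S0.
  by rewrite normr0 expr0n /= mulr0 quad0.
have cS : compact S.
  apply: bounded_closed_compact.
    by exists 1; split => // x x1 v /= ->; exact: ltW.
  rewrite (_ : S = (fun v : 'rV[R]_n => `|v|) @^-1` [set 1]) //.
  by apply: closed_comp; [move=> v _; exact: norm_continuous|exact: closed_eq].
have /set0P Sne := S0.
have [w wS wmin] := EVT_min_rV Sne cS
  (continuous_subspaceT (@quad_continuous n P)).
have w0 : w != 0.
  by move: wS; rewrite inE /S /= -normr_eq0 => ->; rewrite oner_eq0.
exists (quad P w); first exact: Ppos.
move=> v; have [->|v0] := eqVneq v 0.
  by rewrite normr0 expr0n /= mulr0 quad0.
have := wmin _ (mem_set (scale v v0)).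
rewrite quadZ exprVn mulrC ler_pdivlMr // exprn_gt0 //.
by rewrite normr_gt0.
Qed.

Lemma near_norm_lt (V : normedModType R) (x : V) e :
  0 < e -> nbhs x [set y | `|x - y| < e].
Proof. by move=> e0; have := nbhsx_ballx x e e0; rewrite -ball_normE. Qed.

Lemma posdef_near n (Q : 'M[R]_n) : posdef Q ->
  exists c C, [/\ 0 < c, 0 < C & \forall P \near Q,
    forall v, c * `|v| ^+ 2 <= quad P v <= C * `|v| ^+ 2].
Proof.
move=> /posdef_lower[c c0 cQ].
pose K := n%:R ^+ 2 : R.
have K0 : 0 <= K by rewrite /K sqr_ge0.
exists (c / 2), (K * `|Q| + c); split; first by rewrite divr_gt0.
  by apply: ltr_wpDl => //; rewrite mulr_ge0.
have e0 : 0 < c / 2 / (K + 1) by rewrite !divr_gt0 // ltr_wpDl.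
near=> P; move=> v.
have PQ : `|P - Q| <= c / 2 / (K + 1).
  by rewrite distrC ltW //; near: P; exact: near_norm_lt.
have := quad_norm (P - Q) v; rewrite quadB -/K ler_norml.
have := quad_norm Q v; rewrite -/K ler_norml => /andP[_ Qu].
have KPQ : K * `|P - Q| <= c / 2.
  apply: le_trans (_ : (K + 1) * (c / 2 / (K + 1)) <= _).
    by apply: ler_pM => //; lra.
  by rewrite mulrC divfK // gt_eqF // ltr_wpDl.
have := cQ v; have := sqr_ge0 `|v|.
have : 0 <= (c / 2 - K * `|P - Q|) * `|v| ^+ 2 by rewrite mulr_ge0 ?sqr_ge0 ?subr_ge0.
by move: Qu; move: (`|v| ^+ 2) (quad P v) (quad Q v) => u p q; nra.
Unshelve. all: by end_near. Qed.

(** A relative comparison, since logarithms will be taken: the error [P - P'] is measured against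
    the lower bound [c] shared by all forms near [Q]. *)
Lemma posdef_compare n (Q : 'M[R]_n) e : posdef Q -> 0 < e ->
  \forall PP' \near (Q, Q), forall v, quad PP'.1 v <= (1 + e) * quad PP'.2 v.
Proof.
move=> /posdef_near [c [C [c0 _ cQ]]] e0.
pose K := n%:R ^+ 2 : R.
have K0 : 0 <= K by rewrite /K sqr_ge0.
pose d := e * c / (K + 1).
have d0 : 0 < d by rewrite !divr_gt0 ?mulr_gt0 // ltr_wpDl.
exists ([set P | `|Q - P| < d / 2], [set P' | `|Q - P'| < d / 2 /\
    forall v, c * `|v| ^+ 2 <= quad P' v <= C * `|v| ^+ 2]) => /=.
  split.
    by apply: near_norm_lt; rewrite divr_gt0.
  apply: filterI => //.
  by apply: near_norm_lt; rewrite divr_gt0.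
move=> [P P'] /= [PQ [P'Q P'c]] v.
have PP' : `|P - P'| <= d.
  have -> : P - P' = (Q - P') - (Q - P) by rewrite opprB [RHS]addrC subrKA.
  by apply: le_trans (ler_normB _ _) _; lra.
have := quad_norm (P - P') v; rewrite quadB -/K ler_norml.
have KPP : K * `|P - P'| <= e * c.
  apply: le_trans (_ : (K + 1) * d <= _).
    by apply: ler_pM => //; lra.
  by rewrite /d mulrC divfK // gt_eqF // ltr_wpDl.
have /andP[cP' _] := P'c v; have := sqr_ge0 `|v|.
have : 0 <= (e * c - K * `|P - P'|) * `|v| ^+ 2 by rewrite mulr_ge0 ?sqr_ge0 ?subr_ge0.
have : 0 <= e * (quad P' v - c * `|v| ^+ 2) by rewrite mulr_ge0 ?subr_ge0 // ltW.
by move: (`|v| ^+ 2) (quad P v) (quad P' v) => u p q; nra.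
Qed.

End MatrixNorm.

(** * Strict differentiability *)

Section StrictDiff.
Variable R : realType.

(** Both points are free, so a lower bound on [A] controls distances between nearby points directly;
    see [strict_diff_expand]. *)
Definition strict_diff m n (F : 'rV[R]_m -> 'rV[R]_n) (x : 'rV[R]_m)
    (A : 'M[R]_(m, n)) :=
  forall e : R, 0 < e -> \forall yz \near (x, x),
    `|F yz.1 - F yz.2 - (yz.1 - yz.2) *m A| <= e * `|yz.1 - yz.2|.

Lemma strict_diff_differentiable m n (F : 'rV[R]_m -> 'rV[R]_n) x A :
  strict_diff F x A -> differentiable F x /\ jacobian F x = A.
Proof.
move=> FA.
pose df : {linear 'rV[R]_m -> 'rV[R]_n} := mulmxr A.
have Fo : F \o shift x = cst (F x) + df +o_ (0 : 'rV[R]_m) id.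
  apply/eqaddoP => e e0.
  have [[U V] /= [nU nV] UV] := FA e e0.
  have {}nU : \forall h \near (0 : 'rV[R]_m), U (h + x).
    have := nU; rewrite -[nbhs x U]/(\forall y \near x, U y) (near_shift 0 x).
    by rewrite subr0.
  apply: filterS nU => h Uh.
  have := UV (h + x, x) (conj Uh (nbhs_singleton nV)); rewrite /= addrK.
  by congr (`|_| <= _); rewrite -addrA -opprD.
have Ac : continuous df.
  have Ac (v : 'rV[R]_m) : (w *m A @[w --> v] --> v *m A).
    apply: (@cvg_mulmx _ _ (nbhs v) _ _ _ _ id (fun=> A)).
      exact: cvg_id.
    exact: cvg_cst.
  exact: Ac.
have dF := diff_unique Ac Fo.
split; first by apply/diff_locallyP; rewrite dF.
apply/matrixP => i j; rewrite /jacobian mxE dF /df /=.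
by rewrite -rowE mxE.
Qed.

Lemma strict_diff_near m n (F G : 'rV[R]_m -> 'rV[R]_n) x A :
  (\forall y \near x, F y = G y) -> strict_diff F x A -> strict_diff G x A.
Proof.
move=> FG FA e e0.
have [[U V] /= [nU nV] UV] := FA e e0.
exists (U `&` [set y | F y = G y], V `&` [set y | F y = G y]).
  by split; apply: filterI.
move=> [y z] /= [[Uy FGy] [Vz FGz]].
by rewrite -FGy -FGz; exact: (UV (y, z)).
Qed.

Lemma strict_diff_comp m n p (F : 'rV[R]_m -> 'rV[R]_n) (G : 'rV[R]_n -> 'rV[R]_p)
    x A B :
  strict_diff F x A -> strict_diff G (F x) B ->
  strict_diff (G \o F) x (A *m B).
Proof.
move=> FA GB e e0.
have Fc : {for x, continuous F}.
  by apply: differentiable_continuous; have [] := strict_diff_differentiable FA.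
pose a := m%:R * `|A|; pose b := n%:R * `|B|.
have a0 : 0 <= a by rewrite mulr_ge0.
have b0 : 0 <= b by rewrite mulr_ge0.
(* The entry 1 gives the Lipschitz bound [a + 1] for [F]; the other makes [b * e2] at most
   [e / 2]. *)
pose e2 := Num.min 1 (e / 2 / (b + 1)).
have e20 : 0 < e2 by rewrite lt_min ltr01 /= !divr_gt0 // ltr_wpDl.
pose e1 := e / 2 / (a + 1).
have e10 : 0 < e1 by rewrite !divr_gt0 // ltr_wpDl.
have [[U V] /= [nU nV] UV] := GB _ e10.
have [[U' V'] /= [nU' nV'] UV'] := FA _ e20.
exists (U' `&` F @^-1` U, V' `&` F @^-1` V).
  by split; apply: filterI => //; exact: Fc.
move=> [y z] /= [[U'y Uy] [V'z Vz]].
have /= := UV (F y, F z) (conj Uy Vz).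
have /= := UV' (y, z) (conj U'y V'z).
set u := F y - F z; set v := y - z => uv.
have uA : `|u| <= (a + 1) * `|v|.
  rewrite -(subrK (v *m A) u); apply: le_trans (ler_normD _ _) _.
  rewrite addrC mulrDl; apply: lerD; first exact: mx_norm_mul.
  by apply: le_trans uv _; apply: ler_wpM2r => //; rewrite ge_min lexx.
move=> Gu.
rewrite -(subrKA (u *m B)) mulmxA -[u *m B - _]mulmxBl.
apply: le_trans (ler_normD _ _) _.
apply: le_trans (lerD Gu (mx_norm_mul _ _)) _.
rewrite [e in leRHS]splitr mulrDl; apply: lerD.
  apply: le_trans (ler_wpM2l (ltW e10) uA) _.
  by rewrite mulrA /e1 divfK // gt_eqF // ltr_wpDl.
rewrite -/b; apply: le_trans (ler_wpM2l b0 uv) _.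
rewrite mulrA; apply: ler_wpM2r => //.
apply: le_trans (_ : (b + 1) * (e / 2 / (b + 1)) <= _).
  by apply: ler_pM => //; [exact: ltW|rewrite lerDl|rewrite ge_min lexx orbT].
by rewrite mulrC divfK // gt_eqF // ltr_wpDl.
Qed.

Lemma strict_diff_id n (x : 'rV[R]_n) : strict_diff id x 1%:M.
Proof.
move=> e e0; exists (setT, setT) => [|[y z] _] /=.
  by split; exact: filterT.
by rewrite mulmx1 subrr normr0 mulr_ge0 // ltW.
Qed.

Lemma jacobian_cvg m n (F : 'rV[R]_m -> 'rV[R]_n) (x : 'rV[R]_m) :
  (\forall y \near x, differentiable F y) ->
  (forall v, {for x, continuous (fun y => 'D_v F y)}) ->
  jacobian F y @[y --> x] --> jacobian F x.
Proof.
move=> dF cF; apply: (@cvg_mx _ _ (nbhs x) _ _ _ (jacobian F)) => i j.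
have JE (y : 'rV[R]_m) : differentiable F y ->
    'D_(delta_mx 0 i) F y 0 j = jacobian F y i j.
  by move=> dFy; rewrite deriveEjacobian // -rowE mxE.
have JEx := JE x (nbhs_singleton dF).
suff cJ l : 'D_(delta_mx 0 i) F x 0 j = l -> jacobian F y i j @[y --> x] --> l.
  exact: cJ JEx.
move=> <-.
have cD := @cvg_coord _ _ (nbhs x) _ _ _ (fun y => 'D_(delta_mx 0 i) F y) _ 0 j
  (cF (delta_mx 0 i)).
have DJ : {near x, (fun y => 'D_(delta_mx 0 i) F y 0 j) =1 (fun y => jacobian F y i j)}.
  by apply: filterS dF => y /JE.
by move=> U /cD DU; apply: filterS (filterI DJ DU) => y [/= ->].
Qed.

End StrictDiff.

Section StrictDiffC1.
Variable R : realType.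
(** The mean value theorem is applied along the segment one coordinate at a time; in the sup norm
    the intermediate point may differ from one coordinate to the next. *)
Lemma C1_strict_diff m n (F : 'rV[R]_m -> 'rV[R]_n) (x : 'rV[R]_m) :
  (\forall y \near x, differentiable F y) ->
  (forall v, {for x, continuous (fun y => 'D_v F y)}) ->
  strict_diff F x (jacobian F x).
Proof.
move=> dF cF e e0.
pose d := e / (m%:R + 1).
have d0 : 0 < d by rewrite divr_gt0 // ltr_wpDl.
have Jd : \forall y \near x, `|jacobian F x - jacobian F y| <= d.
  exact: (cvgrPdist_le _ _).1 (jacobian_cvg dF cF) d d0.
have [r /= r0 rP] := (nbhs_ballP _ _).1 (filterI dF Jd).
exists (ball x r, ball x r) => /=; first by split; exact: nbhsx_ballx.
move=> [y z] /= [By Bz].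
have seg (t : R) : 0 <= t <= 1 -> ball x r (t *: (y - z) + z).
  move: By Bz; rewrite -ball_normE /= => By Bz /andP[t0 t1].
  have -> : x - (t *: (y - z) + z) = t *: (x - y) + (1 - t) *: (x - z).
    by apply/rowP => i; rewrite !mxE; ring.
  apply: le_lt_trans (ler_normD _ _) _; rewrite !normrZ (ger0_norm t0).
  rewrite ger0_norm ?subr_ge0 //.
  move: (`|x - y|) (`|x - z|) By Bz => a b ar br.
  have [ab|/ltW ba] := leP a b.
    have : 0 <= t * (b - a) by rewrite mulr_ge0 ?subr_ge0.
     lra.
  have : 0 <= (1 - t) * (a - b) by rewrite mulr_ge0 ?subr_ge0.
     lra.
apply: mx_norm_le => [|i l]; first by rewrite mulr_ge0 // ltW.
rewrite ord1 {i}.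
pose h (t : R) : R := F (t *: (y - z) + z) 0 l.
have dh (t : R) : 0 <= t <= 1 ->
    is_derive t 1 h (((y - z) *m jacobian F (t *: (y - z) + z)) 0 l).
  move=> /seg/rP[/= dFt _].
  pose Fs (t : R) := F (t *: (y - z) + z).
  have quotE : (fun s : R => s^-1 *: ((Fs \o shift t) (s *: 1) - Fs t)) =
      (fun s : R => s^-1 *: ((F \o shift (t *: (y - z) + z)) (s *: (y - z)) -
        F (t *: (y - z) + z))).
    apply/funext => s; rewrite /Fs /= scalerDl addrA.
    by rewrite [s *: 1]mulr1.
  have dFs : derivable Fs t 1.
    by rewrite /derivable quotE; exact: diff_derivable.
  have DFs : 'D_1 Fs t = (y - z) *m jacobian F (t *: (y - z) + z).
    by rewrite -deriveEjacobian // /derive quotE.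
  split; first exact: (derivable_mxP _ _ _).1 dFs 0 l.
  by rewrite -DFs derive_mx // mxE.
have tI (t : R) : t \in `]0, 1[%R -> 0 <= t <= 1.
  by rewrite in_itv /= => /andP[/ltW -> /ltW ->].
have hc : {within `[0, 1], continuous h}.
  apply: derivable_within_continuous => t; rewrite in_itv /= => /dh [].
  by [].
have [c] := MVT_segment ler01 (fun t tt => dh t (tI t tt)) hc.
rewrite in_itv /= => /seg/rP[/= _ Jc].
rewrite /h scale1r subrK scale0r add0r subr0 mulr1 => FyzE.
have -> : (F y - F z - (y - z) *m jacobian F x) 0 l =
    ((y - z) *m (jacobian F (c *: (y - z) + z) - jacobian F x)) 0 l.
  by move: FyzE; rewrite mulmxBr !mxE => ->.
apply: le_trans (mx_coord_le _ _ _) _; apply: le_trans (mx_norm_mul _ _) _.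
apply: ler_wpM2r => //.
apply: le_trans (_ : (m%:R + 1) * d <= _).
  rewrite distrC in Jc.
  by apply: (ler_pM _ _ _ Jc); rewrite ?ler0n ?normr_ge0 ?lerDl ?ler01.
by rewrite /d mulrC divfK // gt_eqF // ltr_wpDl.
Qed.

End StrictDiffC1.

(** * Derivatives and metrics in charts *)

Section Charts.
Variables (R : realType) (m : nat) (M : manifold R m).
Implicit Types (i j : atlas M) (x : M) (O : set M).

Lemma dom_chart_at x : dom (chart_at x) x.
Proof. exact: (svalP (cid (manifold_cover x))). Qed.

Lemma dom_nbhs i x : dom i x -> nbhs x (dom i).
Proof. by move=> ix; apply: open_nbhs_nbhs; split => //; exact: open_dom. Qed.

Lemma inv_chart_nbhs i x O :
  dom i x -> nbhs x O -> nbhs (chart i x) (inv_chart i @^-1` O).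
Proof.
by move=> ix nO; apply: (inv_chart_continuous ix); rewrite /= chartK.
Qed.

Lemma chart_image_nbhs i x O :
  dom i x -> nbhs x O -> nbhs (chart i x) (chart i @` (O `&` dom i)).
Proof.
move=> ix nO.
have nim : nbhs (chart i x) (chart i @` dom i).
  by apply: open_nbhs_nbhs; split; [exact: open_chart_image|exists x].
apply: filterS (filterI nim (inv_chart_nbhs ix nO)).
by move=> _ [[y iy <-]] /=; rewrite chartK // => Oy; exists y.
Qed.

End Charts.

Section ManifoldDiff.
Variable R : realType.

(** The charts are parameters so that they can stay fixed while [x] moves, unlike those in
    [tangent_map]. *)
Definition mdiff m n (M : manifold R m) (N : manifold R n) (g : M -> N)
    (i : atlas M) (j : atlas N) (x : M) (A : 'M[R]_(m, n)) :=
  strict_diff (local_expr g i j) (chart i x) A.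

Lemma mdiff_jacobian m n (M : manifold R m) (N : manifold R n) (g : M -> N) i j x A :
  mdiff g i j x A -> jacobian (local_expr g i j) (chart i x) = A.
Proof. by move=> /strict_diff_differentiable []. Qed.

Lemma mdiff_unique m n (M : manifold R m) (N : manifold R n) (g : M -> N) i j x A B :
  mdiff g i j x A -> mdiff g i j x B -> A = B.
Proof. by move=> /mdiff_jacobian <- /mdiff_jacobian <-. Qed.

Lemma mdiff_tangent m n (M : manifold R m) (N : manifold R n) (g : M -> N) x A :
  mdiff g (chart_at x) (chart_at (g x)) x A -> tangent_map g x = A.
Proof. exact: mdiff_jacobian. Qed.

Lemma mdiff_comp m n p (M : manifold R m) (N : manifold R n) (P : manifold R p)
    (g : M -> N) (f : N -> P) i j l (x : M) A B :
  {for x, continuous g} -> dom i x -> dom j (g x) ->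
  mdiff g i j x A -> mdiff f j l (g x) B -> mdiff (f \o g) i l x (A *m B).
Proof.
move=> gc ix jgx gA fB.
have gE : local_expr g i j (chart i x) = chart j (g x).
  by rewrite /local_expr /= chartK.
rewrite /mdiff -gE in fB.
apply: strict_diff_near (strict_diff_comp gA fB).
apply: filterS (inv_chart_nbhs ix (gc _ (dom_nbhs jgx))) => u /= gu.
by rewrite /local_expr /= chartK.
Qed.

Lemma C1_near m n (M : manifold R m) (N : manifold R n) (g : M -> N) (U : set M)
    i j x : Ck_map_on 1 U g -> open U -> U x -> dom i x -> dom j (g x) ->
  (\forall u \near chart i x, differentiable (local_expr g i j) u) /\
  forall v, {for chart i x, continuous (fun u => 'D_v (local_expr g i j) u)}.
Proof.
move=> [gc /(_ i j) /= [dg cg]] oU Ux ix jgx.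
have nU : nbhs x (U `&` g @^-1` dom j).
  apply: filterI; first exact: open_nbhs_nbhs.
  exact: gc Ux _ (dom_nbhs jgx).
split.
  apply: filterS (chart_image_nbhs ix nU) => u [y [[Uy jy] iy] <-].
  by apply: dg; exists y.
by move=> v; apply: cg; exists x.
Qed.

Lemma C1_mdiff m n (M : manifold R m) (N : manifold R n) (g : M -> N) (U : set M)
    i j x : Ck_map_on 1 U g -> open U -> U x -> dom i x -> dom j (g x) ->
  mdiff g i j x (jacobian (local_expr g i j) (chart i x)).
Proof.
move=> g1 oU Ux ix jgx; have [dg cg] := C1_near g1 oU Ux ix jgx.
exact: C1_strict_diff.
Qed.

Lemma C1_jacobian_cvg m n (M : manifold R m) (N : manifold R n) (g : M -> N) (U : set M)
    i j (x : M) : Ck_map_on 1 U g -> open U -> U x -> dom i x -> dom j (g x) ->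
  jacobian (local_expr g i j) (chart i y) @[y --> x] -->
  jacobian (local_expr g i j) (chart i x).
Proof.
move=> g1 oU Ux ix jgx; have [dg cg] := C1_near g1 oU Ux ix jgx.
exact: (cvg_comp _ _ (chart_continuous ix) (jacobian_cvg dg cg)).
Qed.

(** Transition maps are the local expressions of the identity, so that a change of chart becomes an
    instance of the chain rule. *)
Lemma C1_id m (M : manifold R m) : Ck_map_on 1 setT (@id M).
Proof.
split; first by move=> x _; exact: cvg_id.
move=> i j; rewrite setTI -[@id M @^-1` dom j]/(dom j).
exact: (@transition_smooth R m M i j 1%N).
Qed.

Lemma mdiff_id m (M : manifold R m) (i j : atlas M) (x : M) : dom i x -> dom j x ->
  exists T, mdiff (@id M) i j x T.
Proof.
move=> ix jx; exists (jacobian (local_expr (@id M) i j) (chart i x)).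
by apply: (C1_mdiff (@C1_id m M)) => //; exact: openT.
Qed.

Lemma mdiff_id1 m (M : manifold R m) (i : atlas M) (x : M) : dom i x ->
  mdiff (@id M) i i x 1%:M.
Proof.
move=> ix; apply: strict_diff_near (@strict_diff_id R m (chart i x)).
apply: filterS (chart_image_nbhs ix (@filterT _ _ (nbhs_filter x))).
by move=> _ [y [_ iy] <-]; rewrite /local_expr /= chartK.
Qed.

Lemma mdiff_idK m (M : manifold R m) (i j : atlas M) (x : M) T T' :
  dom i x -> dom j x -> mdiff (@id M) i j x T -> mdiff (@id M) j i x T' ->
  T *m T' = 1%:M.
Proof.
move=> ix jx iT jT; apply: (mdiff_unique _ (mdiff_id1 ix)).
by apply: (mdiff_comp (g := @id M) (f := @id M) _ ix jx iT jT); exact: cvg_id.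
Qed.

Definition gnorm m (M : manifold R m) (G : riemannian_metric M) i x v : R :=
  Num.sqrt (quad (gram G i x) v).

Lemma gram_posdef m (M : manifold R m) (G : riemannian_metric M) i x :
  dom i x -> posdef (gram G i x).
Proof. by move=> ix v v0; exact: gram_pos. Qed.

Lemma gram_quad_ge0 m (M : manifold R m) (G : riemannian_metric M) i x v :
  dom i x -> 0 <= quad (gram G i x) v.
Proof.
move=> ix; have [->|v0] := eqVneq v 0; first by rewrite quad0.
exact/ltW/gram_posdef.
Qed.

Lemma gram_cvg m (M : manifold R m) (G : riemannian_metric M) i (x : M) :
  dom i x -> gram G i y @[y --> x] --> gram G i x.
Proof.
move=> ix.
have Gc := @gram_smooth _ _ _ G i 0%N (chart i x) (ex_intro2 _ _ x ix erefl).
have Gc' := cvg_comp _ _ (chart_continuous ix) Gc.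
move=> W nW; rewrite /= chartK // in Gc'.
apply: filterS (filterI (dom_nbhs ix) (Gc' W nW)) => y /= [iy].
by rewrite chartK.
Qed.

Lemma gram_change m (M : manifold R m) (G : riemannian_metric M) i j x T v :
  dom i x -> dom j x -> mdiff (@id M) i j x T ->
  gnorm G i x v = gnorm G j x (v *m T).
Proof.
move=> ix jx iT; rewrite /gnorm (gram_compat G ix jx) /=.
by rewrite -[chart j \o inv_chart i]/(local_expr (@id M) i j) (mdiff_jacobian iT) quad_conj.
Qed.

Lemma tangent_normE m (M : manifold R m) (G : riemannian_metric M) x v :
  tangent_norm G x v = gnorm G (chart_at x) x v.
Proof. by []. Qed.

Lemma gram_bounds m (M : manifold R m) (G : riemannian_metric M) i (x : M) :
  dom i x -> exists c C, [/\ 0 < c, 0 < C & \forall y \near x,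
    forall v, c * `|v| ^+ 2 <= quad (gram G i y) v <= C * `|v| ^+ 2].
Proof.
move=> ix; have [c [C [c0 C0 cC]]] := posdef_near (gram_posdef G ix).
by exists c, C; split => //; exact: (gram_cvg ix cC).
Qed.

(** Near each point, in a fixed chart, both Gram forms are comparable to the squared sup norm. Near
    covering along the filter of large constants makes the ratio uniform. *)
Lemma metric_compare m (M : manifold R m) (G G' : riemannian_metric M) :
  compact [set: M] -> exists2 C, 0 < C &
    forall x v, tangent_norm G x v <= C * tangent_norm G' x v.
Proof.
move=> /compact_near_coveringP cM.
have [|A [_ AP]] := cM R +oo%R (fun C (x : M) => 0 < C /\
    forall v, tangent_norm G x v <= C * tangent_norm G' x v) _.
  move=> p _; set i := chart_at p; have ip : dom i p := dom_chart_at p.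
  have [c [C [c0 C0 cC]]] := gram_bounds G ip.
  have [c' [C' [c'0 C'0 cC']]] := gram_bounds G' ip.
  exists ([set x | dom i x /\ (forall v, quad (gram G i x) v <= (C / c') * quad (gram G' i x) v)],
      [set D | Num.sqrt (C / c') < D]) => /=.
    split; last by apply: nbhs_pinfty_gt.
    apply: filterI; first exact: dom_nbhs.
    apply: filterS (filterI cC cC') => x /= [xC xC'] v.
    have /andP[_ vC] := xC v; have /andP[vc' _] := xC' v.
    apply: le_trans vC _; rewrite mulrAC -mulrA ler_wpM2l ?(ltW C0) //.
    by rewrite ler_pdivlMr // mulrC.
  move=> [x D] /= [[ix GG'] DC].
  have D0 : 0 < D by exact: le_lt_trans (sqrtr_ge0 _) DC.
  split => // v.
  have [T iT] := mdiff_id (dom_chart_at x) ix.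
  rewrite !tangent_normE !(gram_change _ _ (dom_chart_at x) ix iT).
  apply: le_trans (_ : Num.sqrt (C / c') * gnorm G' i x (v *m T) <= _).
    rewrite /gnorm -sqrtrM ?divr_ge0 ?(ltW C0) ?(ltW c'0) //.
    by rewrite ler_wsqrtr.
  by rewrite ler_wpM2r ?sqrtr_ge0 // ltW.
have AB : A < Num.max A 0 + 1 by rewrite (@le_lt_trans _ _ (Num.max A 0)) ?le_max ?lexx // ltrDl.
exists (Num.max A 0 + 1); last by move=> x v; exact: (AP _ AB x I).2.
by rewrite ltr_wpDl // le_max lexx orbT.
Qed.

(** [T] is the transition from [i] to [chart_at x]; the transition at the target is absorbed into
    [A], since only the norm of the image matters. *)
Lemma mdiff_change m n (M : manifold R m) (N : manifold R n) (g : M -> N) i j (x : M) :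
  {for x, continuous g} -> dom i x -> dom j (g x) ->
  mdiff g (chart_at x) (chart_at (g x)) x (tangent_map g x) ->
  exists (T : 'M[R]_m) (A : 'M[R]_(m, n)), [/\ mdiff g i j x A,
    T \in unitmx,
    (forall (G : riemannian_metric M) v, gnorm G i x v = tangent_norm G x (v *m T)) &
    (forall (G : riemannian_metric N) v, gnorm G j (g x) (v *m A) =
       tangent_norm G (g x) (v *m T *m tangent_map g x))].
Proof.
move=> gc ix jgx gD.
have cx := dom_chart_at x; have cgx := dom_chart_at (g x).
have [T iT] := mdiff_id ix cx; have [T' iT'] := mdiff_id cx ix.
have [S jS] := mdiff_id cgx jgx.
exists T, (T *m tangent_map g x *m S); split.
- have gT : mdiff g i (chart_at (g x)) x (T *m tangent_map g x).
    by apply: (mdiff_comp (g := @id M) (f := g) _ ix cx iT gD); exact: cvg_id.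
  exact: (mdiff_comp (g := g) (f := @id N) gc ix cgx gT jS).
- by have [] := mulmx1_unit (mdiff_idK ix cx iT iT').
- by move=> G v; rewrite tangent_normE; exact: gram_change.
- by move=> G v; rewrite tangent_normE (gram_change _ _ cgx jgx jS) !mulmxA.
Qed.

Lemma C1_mdiff_iter m (M : manifold R m) (f : M -> M) k x : Ck_map_on 1 setT f ->
  mdiff (iter k f) (chart_at x) (chart_at (iter k f x)) x (tangent_map (iter k f) x).
Proof.
move=> f1; elim: k => [|k IH].
  have id1 := mdiff_id1 (dom_chart_at x).
  by rewrite (mdiff_tangent (g := iter 0 f) id1).
have fk : continuous (iter k f) by apply: iter_continuous => z; exact: f1.1.
have cx := dom_chart_at x; have ckx := dom_chart_at (iter k f x).
have fS := mdiff_comp (f := f) (fk x) cx ckx IH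
  (C1_mdiff f1 openT I ckx (dom_chart_at (f (iter k f x)))).
by rewrite (mdiff_tangent (g := iter k.+1 f) fS).
Qed.

Lemma tangent_map_iterS m (M : manifold R m) (f : M -> M) k x : Ck_map_on 1 setT f ->
  tangent_map (iter k.+1 f) x = tangent_map (iter k f) x *m tangent_map f (iter k f x).
Proof.
move=> f1.
have fk : continuous (iter k f) by apply: iter_continuous => z; exact: f1.1.
apply: mdiff_tangent.
exact: (mdiff_comp (f := f) (fk x) (dom_chart_at x) (dom_chart_at _)
  (C1_mdiff_iter k x f1) (C1_mdiff f1 openT I (dom_chart_at _) (dom_chart_at _))).
Qed.

Lemma tangent_map_iter0 m (M : manifold R m) (f : M -> M) x :
  tangent_map (iter 0 f) x = 1%:M.
Proof. exact: (mdiff_tangent (g := iter 0 f) (mdiff_id1 (dom_chart_at x))). Qed.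

End ManifoldDiff.

(** * Expanding maps are expansive *)

Lemma near_seq (T : Type) (I : eqType) (F : set_system T) (s : seq I)
    (P : I -> set T) :
  Filter F -> (forall i, i \in s -> F (P i)) ->
  F [set x | forall i, i \in s -> P i x].
Proof.
move=> FF; elim: s => [|i s IH] sP; first by apply: filterE => x i; rewrite in_nil.
have Fs : F [set x | forall i, i \in s -> P i x].
  by apply: IH => j js; apply: sP; rewrite in_cons js orbT.
apply: filterS (filterI (sP i (mem_head _ _)) Fs) => x [Pix Px] j.
by rewrite in_cons => /predU1P[->|/Px].
Qed.

Lemma expr_unbounded (R : realType) (s D : R) : 1 < s -> exists k, D <= s ^+ k.
Proof.
move=> s1.
have bern k : 1 + k%:R * (s - 1) <= s ^+ k.
  elim: k => [|k IH]; first by rewrite mul0r addr0 expr0.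
  rewrite exprS -natr1; have : 0 <= (s - 1) * (s ^+ k - 1 - k%:R * (s - 1)).
    by rewrite mulr_ge0 //; lra.
  have : 0 <= k%:R * (s - 1) ^+ 2 by rewrite mulr_ge0 ?sqr_ge0.
  by move: (s ^+ k) (k%:R) => u t; nra.
have s10 : 0 < s - 1 by rewrite subr_gt0.
exists (Num.bound (D / (s - 1))); apply: le_trans (bern _).
have [D0|D0] := leP D 0; first by apply: le_trans D0 _; rewrite addr_ge0 // mulr_ge0 // ltW.
have := archi_boundP (ltW (divr_gt0 D0 s10)).
by rewrite ltr_pdivrMr // => /ltW h; apply: le_trans h _; rewrite lerDr.
Qed.

Lemma exists_upper_bound (R : realType) (I : eqType) (s : seq I) (c : I -> R) :
  exists D, forall a, a \in s -> c a <= D.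
Proof.
exists (\sum_(a <- s) `|c a|) => a as_.
rewrite (big_rem a) //=; apply: le_trans (ler_norm _) _.
by rewrite lerDl sumr_ge0.
Qed.

(** The factor drops from 3 to 2 because the error of strict differentiability is taken with
    constant 1. *)
Lemma strict_diff_expand (R : realType) m n (F : 'rV[R]_m -> 'rV[R]_n) (x : 'rV[R]_m) A :
  strict_diff F x A -> (forall v : 'rV[R]_m, 3 * `|v| <= `|v *m A|) ->
  \forall yz \near (x, x), 2 * `|yz.1 - yz.2| <= `|F yz.1 - F yz.2|.
Proof.
move=> FA A3; have [UV nUV UVP] := FA 1 ltr01; exists UV => // -[y z] yz /=.
have := UVP _ yz; rewrite /= mul1r => h.
have := A3 (y - z); have := lerB_dist ((y - z) *m A) (F y - F z).
by rewrite distrC; move: h; lra.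
Qed.

Section Expansive.
Variables (R : realType) (n : nat) (N : manifold R n) (GN : riemannian_metric N).
Variable f : N -> N.
Hypotheses (cN : compact [set: N]) (fexp : expanding GN f).

(** The set [q.1] is closed so that conditions of the form [q.1 z -> ...] hold vacuously near any
    point outside it. *)
Let good (p : N) (q : set N * (R * R)) :=
  [/\ nbhs p q.1, closed q.1, q.1 `<=` dom (chart_at p),
    (0 < q.2.1 /\ 0 < q.2.2) &
    forall y, q.1 y -> forall v, q.2.1 * `|v| ^+ 2 <=
      quad (gram GN (chart_at p) y) v <= q.2.2 * `|v| ^+ 2].

Let exists_good p : exists q, good p q.
Proof.
have [c [C [c0 C0 cC]]] := gram_bounds GN (dom_chart_at p).
have [K nK Ksub] := @compact_regular N p setT (@manifold_hausdorff _ _ N) cN filterT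
  _ (filterI (dom_nbhs (dom_chart_at p)) cC).
exists (closure K, (c, C)); split => //=.
- by apply: filterS nK; exact: subset_closure.
- exact: closed_closure.
- by move=> y /Ksub [].
- by move=> y /Ksub [].
Qed.

(* The chart [chart_at x] depends on [x] arbitrarily, so distances are measured in
   finitely many fixed charts; a large iterate of [f] expands enough to absorb
   the distortion between them. *)
Lemma expanding_expansive : exists E0 : set (N * N),
  [/\ closed E0, diag_nbhd E0, (forall x y, E0 (x, y) -> E0 (y, x)) &
    forall x y, (forall k, E0 (iter k f x, iter k f y)) -> x = y].
Proof.
have [f1 [c [s [c0 s1 fE]]]] := fexp.
have [q qP] := choice exists_good.
have qn p : nbhs p (q p).1 by have [] := qP p.
have [sq sqP] := compact_seq_cover cN qn.
(* Here 9 is the square of 3: the squared expansion factor must reach this ratio for an iterate to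
   multiply sup norms by 3 from chart [a] to chart [b]. *)
have [D DP] := @exists_upper_bound R _ [seq (a, b) | a <- sq, b <- sq]
  (fun ab => 9 * (q ab.2).2.2 / (q ab.1).2.1).
(* [c * s ^+ k] is at least [|D| + 1], hence at least 1, so its square dominates [D] too. *)
have [k kD] := @expr_unbounded R s ((`|D| + 1) / c) s1.
have csk a b : a \in sq -> b \in sq ->
    9 * (q b).2.2 <= (c * s ^+ k) ^+ 2 * (q a).2.1.
  move=> a_s b_s; have [_ _ _ [cl0 _] _] := qP a.
  rewrite -ler_pdivrMr //.
  apply: le_trans (DP (a, b) _) _; first by apply/allpairsP; exists (a, b).
  have : `|D| + 1 <= c * s ^+ k by move: kD; rewrite ler_pdivrMr // mulrC.
  have := ler_norm D; have := normr_ge0 D.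
  by move: (c * s ^+ k) `|D| => u d; nra.
pose F := iter k f.
have fc : continuous f by move=> x; exact: f1.1.
have Fc : continuous F by exact: iter_continuous.
have F3 p a b : a \in sq -> b \in sq -> (q a).1 p -> (q b).1 (F p) ->
    exists2 A, mdiff F (chart_at a) (chart_at b) p A & forall v : 'rV[R]_n, 3 * `|v| <= `|v *m A|.
  move=> a_s b_s Kp KFp.
  have [_ _ aK [cl0 _] qa] := qP a; have [_ _ bK [_ Cu0] qb] := qP b.
  have [T [A [FA _ iT jA]]] := mdiff_change (Fc p) (aK _ Kp) (bK _ KFp) (C1_mdiff_iter k p f1).
  exists A => // v.
  have csk0 : 0 <= c * s ^+ k by rewrite mulr_ge0 ?exprn_ge0 ?(ltW c0) //; lra.
  have : (c * s ^+ k * gnorm GN (chart_at a) p v) ^+ 2 <= gnorm GN (chart_at b) (F p) (v *m A) ^+ 2.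
    have fk : c * s ^+ k * gnorm GN (chart_at a) p v <= gnorm GN (chart_at b) (F p) (v *m A).
      by rewrite iT jA; exact: fE.
    apply: lerXn2r fk; rewrite nnegrE; last exact: sqrtr_ge0.
    by rewrite mulr_ge0 //; exact: sqrtr_ge0.
  rewrite exprMn /gnorm !sqr_sqrtr ?gram_quad_ge0 //; [|exact: bK|exact: aK].
  move=> h.
  have /andP[h1 _] := qa _ Kp v; have /andP[_ h2] := qb _ KFp (v *m A).
  have h3 : 9 * (q b).2.2 * `|v| ^+ 2 <= (q b).2.2 * `|v *m A| ^+ 2.
    apply: le_trans (ler_wpM2r (sqr_ge0 `|v|) (csk a b a_s b_s)) _.
    apply: le_trans h2; apply: le_trans h; rewrite -mulrA.
    exact: (ler_wpM2l (sqr_ge0 _) h1).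
  have vA0 := normr_ge0 (v *m A).
  rewrite leNgt; apply/negP => v3.
  have : `|v *m A| ^+ 2 < 9 * `|v| ^+ 2 by have := normr_ge0 v; nra.
  by rewrite -(ltr_pM2l Cu0) ltNge mulrA (mulrC _ 9) h3.
(* Doubling is required from every chart around [z.1] to every chart around [F z.1]; the cap 1 is
   what repeated doubling will violate, and the domain condition lets the chart separate [z.1] from
   [z.2] at the end. *)
pose P (a : N) : set (N * N) := [set z | (q a).1 z.1 ->
  [/\ forall b, b \in sq -> (q b).1 (F z.1) ->
      2 * `|chart (chart_at a) z.1 - chart (chart_at a) z.2| <=
      `|chart (chart_at b) (F z.1) - chart (chart_at b) (F z.2)|,
    dom (chart_at a) z.2 &
    `|chart (chart_at a) z.1 - chart (chart_at a) z.2| <= 1]].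
have dP : diag_nbhd [set z | forall a, a \in sq -> P a z].
  move=> p; apply: near_seq => a a_s; have [_ aKcl aK _ _] := qP a.
  have [Kp|nKp] := pselect ((q a).1 p); last first.
    exists (~` (q a).1, setT) => /=; last by move=> [y z] [].
    split; last exact: filterT.
    by apply: open_nbhs_nbhs; split => //; exact: closed_openC.
  have pa := aK _ Kp; have ca := chart_continuous pa.
  have near1 : nbhs (p, p) [set z | dom (chart_at a) z.1 /\ dom (chart_at a) z.2 /\
      `|chart (chart_at a) z.1 - chart (chart_at a) z.2| <= 1].
    pose B := [set y : N | dom (chart_at a) y /\
      `|chart (chart_at a) p - chart (chart_at a) y| < 2^-1].
    have nB : nbhs p B.
      apply: filterI; first exact: dom_nbhs.
      have h2 : 0 < 2^-1 :> R by rewrite invr_gt0.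
      exact: (ca _ (near_norm_lt (chart (chart_at a) p) h2)).
    exists (B, B) => // -[y z] [/= [ya yp] [za zp]]; split => //; split => //.
    rewrite -(subrKA (chart (chart_at a) p)); apply: le_trans (ler_normD _ _) _.
    by rewrite distrC; lra.
  have near2 : nbhs (p, p) [set z | forall b, b \in sq -> (q b).1 (F z.1) ->
      dom (chart_at a) z.1 -> dom (chart_at a) z.2 ->
      2 * `|chart (chart_at a) z.1 - chart (chart_at a) z.2| <=
      `|chart (chart_at b) (F z.1) - chart (chart_at b) (F z.2)|].
    apply: near_seq => b b_s; have [_ bKcl _ _ _] := qP b.
    have [KFp|nKFp] := pselect ((q b).1 (F p)); last first.
      exists (F @^-1` ~` (q b).1, setT) => /=; last by move=> [y z] [].
      split; last exact: filterT.
      have nC : nbhs (F p) (~` (q b).1).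
        by apply: open_nbhs_nbhs; split => //; exact: closed_openC.
      exact: (Fc p _ nC).
    have [A FA A3] := F3 _ _ _ a_s b_s Kp KFp.
    have [[U V] /= [nU nV] UV] := strict_diff_expand FA A3.
    exists (chart (chart_at a) @^-1` U, chart (chart_at a) @^-1` V).
      by split; [exact: (ca _ nU)|exact: (ca _ nV)].
    move=> [y z] /= [Uy Vz] _ ya za.
    by have := UV (_, _) (conj Uy Vz); rewrite /local_expr /= !chartK.
  apply: filterS (filterI near1 near2) => z [[z1 [z2 z12]] zb] Kz; split => // b bs KFz.
  exact: zb.
have [E0 [E0cl E0n E0s E0P]] := closed_diag_nbhd cN (@manifold_hausdorff _ _ N) dP.
exists E0; split => // x y Exy.
have orbitF j z : iter j F z = iter (j * k) f z.
  by elim: j => [//|j IH]; rewrite iterS IH /F -iterD mulSn.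
have PF j a : a \in sq -> P a (iter j F x, iter j F y).
  by move: a; apply: E0P; rewrite !orbitF.
have sqP' j : exists a, a \in sq /\ (q a).1 (iter j F x).
  by have [a a_s Ka] := sqP (iter j F x); exists a.
have [a aP] := choice sqP'.
(* The chart [a j] varies with [j], but doubling holds between any two of the chosen charts. *)
pose d j := `|chart (chart_at (a j)) (iter j F x) - chart (chart_at (a j)) (iter j F y)|.
have dS j : 2 * d j <= d j.+1.
  have [aj_s Kj] := aP j; have [ajS_s KjS] := aP j.+1.
  by have [dj _ _] := PF j _ aj_s Kj; exact: dj.
have d1 j : d j <= 1.
  by have [aj_s Kj] := aP j; have [_ _ dj] := PF j _ aj_s Kj; exact: dj.
(* Linear growth already contradicts the cap, by the Archimedean property. *)
have dlin j : j.+1%:R * d 0 <= d j.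
  elim: j => [|j IH]; first by rewrite mul1r.
  have d00 : 0 <= d 0 by exact: normr_ge0.
  have d0j : d 0 <= d j by apply: le_trans IH; rewrite ler_peMl // ler1n.
  by apply: le_trans (dS j); rewrite -natr1 mulrDl mul1r; lra.
have d0 : d 0 = 0.
  apply/eqP; rewrite eq_le normr_ge0 andbT leNgt; apply/negP => dgt0.
  have := archi_boundP (ltW (divr_gt0 ltr01 dgt0)); rewrite ltr_pdivrMr //.
  have := dlin (Num.bound (1 / d 0)); have := d1 (Num.bound (1 / d 0)).
  by rewrite -natr1; lra.
have [a0_s K0] := aP 0; have [_ dy _] := PF 0 _ a0_s K0.
have [_ _ dx _ _] := qP (a 0).
move/eqP: d0; rewrite normr_eq0 subr_eq0 => /eqP xy.
by rewrite -[LHS](chartK (dx x K0)) -[RHS](chartK dy) /= xy.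
Qed.

End Expansive.

(** * Birkhoff sums and local diffeomorphisms *)

Lemma limn_einf_le_frequently (R : realType) (u : nat -> R) (eta d : R) (N : nat) :
  (limn_einf (fun n => (u n)%:E) <= eta%:E)%E -> 0 < d ->
  exists2 n, (N <= n)%N & u n <= eta + d.
Proof.
move=> ueta d0; apply: contrapT => nu.
have : (einfs (fun n => (u n)%:E) N <= eta%:E)%E.
  apply: le_trans ueta.
  have uE : limn (einfs (fun n => (u n)%:E)) = ereal_sup (range (einfs (fun n => (u n)%:E))).
    by apply/cvg_lim => //; exact: cvg_einfs_sup.
  rewrite limn_einf_lim uE.
  by apply: ereal_sup_ubound; exists N.
apply/negP; rewrite -ltNge.
apply: lt_le_trans (_ : ((eta + d)%:E <= _)%E); first by rewrite lte_fin ltrDl.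
apply: le_ereal_inf_tmp => _ [n /= Nn <-]; rewrite lee_fin leNgt; apply/negP => un.
by apply: nu; exists n => //; exact: ltW.
Qed.

(** With [T] the mean over a period, [S n - n%:R * T] is periodic, hence bounded; so the averages
    tend to [T], which is therefore their lower limit. *)
Lemma periodic_average_le (R : realType) (a : nat -> R) (k : nat) (eta : R) :
  (0 < k)%N -> (forall n, a (k + n)%N = a n) ->
  (limn_einf (fun n => (n%:R^-1 * \sum_(0 <= j < n) a j)%:E) <= eta%:E)%E ->
  \sum_(0 <= j < k) a j <= eta *+ k.
Proof.
move=> k0 ak aeta.
pose S n := \sum_(0 <= j < n) a j.
have Sk n : S (k + n)%N = S k + S n.
  rewrite /S (@big_cat_nat _ _ _ k) //= ?leq_addr //; congr (_ + _).
  rewrite -{1}(add0n k) big_addn addKn.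
  by apply: eq_bigr => j _; rewrite addnC ak.
pose T := S k / k%:R.
have kR0 : 0 < k%:R :> R by rewrite ltr0n.
pose b n := S n - n%:R * T.
have bk n : b (k + n)%N = b n.
  by rewrite /b Sk natrD mulrDl /T mulrCA divff ?gt_eqF // mulr1; lra.
have bmod n : b n = b (n %% k)%N.
  rewrite {1}(divn_eq n k); elim: (n %/ k)%N => [//|q IH].
  by rewrite mulSn -addnA bk.
pose C := \sum_(0 <= r < k) `|b r|.
have bC n : - C <= b n.
  rewrite bmod lerNl; apply: le_trans (ler_norm _) _; rewrite normrN.
  have nk : (n %% k < k)%N by rewrite ltn_mod.
  rewrite /C big_mkord (bigD1 (Ordinal nk)) //= lerDl.
  by apply: sumr_ge0.
have C0 : 0 <= C by apply: sumr_ge0.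
suff : T <= eta by rewrite /T ler_pdivrMr // mulr_natr.
rewrite leNgt; apply/negP => etaT.
pose d := (T - eta) / 2.
have d0 : 0 < d by rewrite divr_gt0 // subr_gt0.
(* For [n] beyond [C / d] the bounded error [C] is smaller than the gap [n * d]; the successor
   ensures [n > 0]. *)
have [n Nn un] := limn_einf_le_frequently (Num.bound (C / d)).+1 aeta d0.
have n0 : 0 < n%:R :> R by rewrite ltr0n; case: n Nn {un}.
have CdN : C < n%:R * d.
  rewrite -ltr_pdivrMr //; apply: lt_trans (archi_boundP _) _.
    by rewrite divr_ge0 // ltW.
  by rewrite ltr_nat.
move: un; rewrite mulrC ler_pdivrMr // => un.
have := bC n; rewrite /b -[\sum_(_ <= _ < _) _]/(S n) in un *.
by move: un CdN; rewrite /d; move: (S n) (n%:R) => s N; lra.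
Qed.

(** An inequality, so that a vanishing argument is allowed: the norm of the inverse derivative is 0
    in dimension 0. *)
Lemma expR_ln_ge (R : realType) (x : R) : x <= expR (ln x).
Proof.
have [x0|x0] := ltP 0 x; first by rewrite lnK.
by apply: le_trans x0 _; exact: expR_ge0.
Qed.

(** The two inequalities make [x] and [y] vanish together, which keeps the default value of [ln] at
    0 from being compared with a genuine logarithm. *)
Lemma ln_le_add (R : realType) (x y d : R) :
  0 <= x -> 0 <= y -> 0 <= d -> x <= expR d * y -> y <= expR d * x -> ln x <= ln y + d.
Proof.
move=> x0 y0 d0 xy yx; have [y_gt0|] := ltP 0 y; last first.
  move=> yle; have yE : y = 0 by apply/eqP; rewrite eq_le yle y0.
  rewrite yE mulr0 in xy; have -> : x = 0 by apply/eqP; rewrite eq_le xy x0.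
  by rewrite yE lerDl.
have x_gt0 : 0 < x.
  by rewrite lt_neqAle x0 andbT; apply/eqP => xE; move: yx; rewrite -xE mulr0 leNgt y_gt0.
rewrite -[d in leRHS]expRK addrC -lnM ?posrE ?expR_gt0 //.
by rewrite ler_ln ?posrE // mulr_gt0 // expR_gt0.
Qed.

Lemma C2_C1 (R : realType) m n (M : manifold R m) (N : manifold R n) (U : set M)
    (g : M -> N) : Ck_map_on 2 U g -> Ck_map_on 1 U g.
Proof.
move=> [gc g2]; split=> // i j; have [dg cg] := g2 i j; split => // v.
by have [d2 _] := cg v; move=> x Ux; apply: differentiable_continuous; exact: d2.
Qed.

(** * The norm of the inverse derivative of a local diffeomorphism *)

Section LocalDiffeo.
Variables (R : realType) (m : nat) (M : manifold R m) (g : M -> M).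
Hypothesis gloc : local_diffeomorphism 2 g.

Lemma local_diffeo_C1 : Ck_map_on 1 setT g.
Proof.
split=> [x _|i j].
  by have [U [V [h [[_ Ux] _ _ [[gc _] _ _]]]]] := gloc x; exact: gc.
split=> [_ [x [[_ jgx] ix] <-]|v _ [x [[_ jgx] ix] <-]];
  have [U [V [h [[oU Ux] _ _ [/C2_C1 g1 _ _]]]]] := gloc x;
  have [_ /(_ i j) /= [dg cg]] := g1.
  by apply: dg; exists x.
by apply: cg; exists x.
Qed.

Lemma local_diffeo_continuous : continuous g.
Proof. by move=> x; exact: local_diffeo_C1.1. Qed.

Lemma local_diffeo_open x O : nbhs x O -> nbhs (g x) (g @` O).
Proof.
move=> nO; have [U [V [h [[oU Ux] oV [gU _ gsurj] [_ [hc _] hg]]]]] := gloc x.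
have Vgx : V (g x) by exact: gU.
have nV : nbhs (g x) V by exact: open_nbhs_nbhs.
have nh : nbhs (g x) (h @^-1` O) by apply: hc => //=; rewrite hg.
apply: filterS (filterI nV nh) => y [/gsurj [u Uu <-]] /=.
by rewrite hg // => Ou; exists u.
Qed.

Lemma local_diffeo_unitmx x : tangent_map g x \in unitmx.
Proof.
have [U [V [h [[oU Ux] oV [gU _ _] [_ /C2_C1 h1 hg]]]]] := gloc x.
have Vgx : V (g x) by exact: gU.
have cx := dom_chart_at x; have cgx := dom_chart_at (g x).
have chx : dom (chart_at x) (h (g x)) by rewrite hg.
have gA := C1_mdiff local_diffeo_C1 openT I cx cgx.
have hB := C1_mdiff h1 oV Vgx cgx chx.
have hgAB := mdiff_comp (f := h) (@local_diffeo_continuous x) cx cgx gA hB.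
have id1 : mdiff (h \o g) (chart_at x) (chart_at x) x 1%:M.
  apply: strict_diff_near (mdiff_id1 cx).
  have nU : nbhs x U by exact: open_nbhs_nbhs.
  by apply: filterS (inv_chart_nbhs cx nU) => u /= Uu; rewrite /local_expr /= hg.
have AB1 := mdiff_unique hgAB id1.
have [Au _] := mulmx1_unit AB1.
exact: Au.
Qed.

Variable G : riemannian_metric M.
Local Notation D := (tangent_map g).
Local Notation Ninv := (norm_inv_tangent_map G g).

Lemma tangent_norm0 x : tangent_norm G x 0 = 0.
Proof. by rewrite /tangent_norm !mul0mx mxE sqrtr0. Qed.

Lemma tangent_normZ x a v : tangent_norm G x (a *: v) = `|a| * tangent_norm G x v.
Proof.
by rewrite !tangent_normE /gnorm quadZ sqrtrM ?sqr_ge0 // sqrtr_sqr.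
Qed.

Lemma tangent_norm_ge0 x v : 0 <= tangent_norm G x v.
Proof. exact: sqrtr_ge0. Qed.

Lemma tangent_norm_gt0 x v : v != 0 -> 0 < tangent_norm G x v.
Proof. by move=> v0; rewrite sqrtr_gt0; exact: gram_pos (dom_chart_at x) _ v0. Qed.

Let S x := [set tangent_norm G x (w *m invmx (D x)) |
       w in [set w | tangent_norm G (g x) w <= 1]].

Let S0 x : S x 0.
Proof. by exists 0; rewrite /= ?mul0mx tangent_norm0. Qed.

(** Needed for [sup] to be a true least upper bound instead of a default value. *)
Let S_bounded x : has_ubound (S x).
Proof.
have [c [C [c0 C0 cC]]] := gram_bounds G (dom_chart_at (g x)).
have [c' [C' [c'0 C'0 cC']]] := gram_bounds G (dom_chart_at x).
pose K := m%:R * `|invmx (D x)|.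
exists (Num.sqrt (C' * (K ^+ 2 / c))) => _ [w /= w1 <-].
rewrite tangent_normE /gnorm ler_wsqrtr //.
have /andP[_ h1] := nbhs_singleton cC' (w *m invmx (D x)).
apply: le_trans h1 _; apply: ler_wpM2l; first exact: ltW.
have h2 : c * `|w| ^+ 2 <= 1.
  have /andP[h2 _] := nbhs_singleton cC w; apply: le_trans h2 _.
  rewrite -[leLHS]sqr_sqrtr; last exact: gram_quad_ge0 (dom_chart_at _).
  by rewrite expr_le1 // sqrtr_ge0.
rewrite ler_pdivlMr //.
have h3 : `|w *m invmx (D x)| ^+ 2 <= (K * `|w|) ^+ 2.
  by rewrite lerXn2r ?nnegrE ?mulr_ge0 //; exact: mx_norm_mul.
apply: le_trans (ler_wpM2r (ltW c0) h3) _.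
rewrite exprMn -mulrA (mulrC _ c) -[leRHS]mulr1.
by apply: ler_wpM2l => //; exact: sqr_ge0.
Qed.

Lemma norm_inv_ge0 x : 0 <= Ninv x.
Proof. exact: (ub_le_sup (S_bounded x) (S0 x)). Qed.

Lemma norm_inv_bound x v : tangent_norm G x v <= Ninv x * tangent_norm G (g x) (v *m D x).
Proof.
have U := local_diffeo_unitmx x.
have [vD0|vD0] := eqVneq (v *m D x) 0.
  have -> : v = 0 by rewrite -(mulmxK U v) vD0 mul0mx.
  by rewrite mul0mx !tangent_norm0 mulr0.
have t0 := tangent_norm_gt0 (g x) vD0.
rewrite -ler_pdivrMr //; apply: (ub_le_sup (S_bounded x)).
exists ((tangent_norm G (g x) (v *m D x))^-1 *: (v *m D x)) => /=.
  by rewrite tangent_normZ ger0_norm ?invr_ge0 ?tangent_norm_ge0 // mulVf // gt_eqF.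
by rewrite -scalemxAl mulmxK // tangent_normZ ger0_norm ?invr_ge0 ?tangent_norm_ge0 // mulrC.
Qed.

(** Together with [norm_inv_bound] this describes the norm as a least constant, free of inverse
    matrices; that is the form in which two base points are compared. *)
Lemma norm_inv_least x C : 0 <= C ->
  (forall v, tangent_norm G x v <= C * tangent_norm G (g x) (v *m D x)) -> Ninv x <= C.
Proof.
move=> C0 CP; apply: ge_sup; first by exists 0; exact: S0.
move=> _ [w /= w1 <-]; apply: le_trans (CP _) _.
rewrite mulmxKV ?local_diffeo_unitmx // -[leRHS]mulr1.
exact: ler_wpM2l.
Qed.

Lemma norm_inv_near (p : M) (e : R) : 0 < e -> exists2 W, nbhs p W &
  forall x y, W x -> W y -> Ninv x <= (1 + e) * Ninv y.
Proof.
move=> e0; set i := chart_at p; set j := chart_at (g p).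
have ip : dom i p := dom_chart_at p; have jp : dom j (g p) := dom_chart_at (g p).
have g1 := local_diffeo_C1; have gc := local_diffeo_continuous.
have chg x : dom i x -> dom j (g x) -> exists T A, [/\ mdiff g i j x A,
    T \in unitmx, (forall G v, gnorm G i x v = tangent_norm G x (v *m T)) &
    (forall G v, gnorm G j (g x) (v *m A) = tangent_norm G (g x) (v *m T *m D x))].
  move=> ix jx; apply: mdiff_change => //; first exact: gc.
  by apply: (C1_mdiff g1 openT I); exact: dom_chart_at.
pose A x := jacobian (local_expr g i j) (chart i x).
(* The Gram matrix at [x], in the chart [i], of the metric pulled back by [g]. *)
pose Q x := A x *m gram G j (g x) *m (A x)^T.
have QE x v : quad (Q x) v = quad (gram G j (g x)) (v *m A x) by exact: quad_conj.
have Qc : Q x @[x --> p] --> Q p.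
  have Ac := C1_jacobian_cvg g1 openT I ip jp.
  have Gc := cvg_comp _ _ (gc p) (gram_cvg (G := G) jp).
  apply: (@cvg_mulmx _ _ (nbhs p) _ _ _ _ (fun x => A x *m gram G j (g x)) (fun x => (A x)^T)).
    exact: (@cvg_mulmx _ _ (nbhs p) _ _ _ _ A (fun x => gram G j (g x)) _ _ Ac Gc).
  exact: (@cvg_trmx _ _ (nbhs p) _ _ _ A _ Ac).
have Qpos : posdef (Q p).
  move=> v v0; have [T [B [/mdiff_jacobian AB Tu _ gB]]] := chg p ip jp.
  rewrite /Q quad_conj /A AB -sqrtr_gt0.
  have := gB G v; rewrite /gnorm => ->; apply: tangent_norm_gt0.
  apply: contraNneq v0 => vTD.
  by rewrite -(mulmxK Tu v) -(mulmxK (local_diffeo_unitmx p) (v *m T)) vTD !mul0mx.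
have near1 := posdef_compare (gram_posdef G ip) e0.
have near2 := posdef_compare Qpos e0.
have [[U1 V1] /= [nU1 nV1] UV1] := near1.
have [[U2 V2] /= [nU2 nV2] UV2] := near2.
exists (dom i `&` (g @^-1` dom j) `&` [set x | (U1 `&` V1) (gram G i x)] `&`
    [set x | (U2 `&` V2) (Q x)]).
  apply: filterI; last exact: (Qc _ (filterI nU2 nV2)).
  apply: filterI; last exact: (gram_cvg (G := G) ip (filterI nU1 nV1)).
  by apply: filterI; [exact: dom_nbhs|exact: (gc p _ (dom_nbhs jp))].
move=> x y [[[ix jx] [/= U1x _]] [/= _ V2x]] [[[iy jy] [/= _ V1y]] [/= U2y _]].
have [T [B [/mdiff_jacobian AB Tu TE BE]]] := chg x ix jx.
have [T' [B' [/mdiff_jacobian AB' Tu' TE' BE']]] := chg y iy jy.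
have AxB : A x = B := AB.
have AyB : A y = B' := AB'.
have e10 : 0 <= 1 + e by rewrite addr_ge0 // ltW.
(* A ratio [1 + e] of quadratic forms is a ratio [r] of norms; one factor [r] comes from the metric
   and one from its pull-back. *)
pose r := Num.sqrt (1 + e).
have rr : r * r = 1 + e by rewrite -expr2 sqr_sqrtr.
have h1 v : gnorm G i x v <= r * gnorm G i y v.
  rewrite /gnorm /r -sqrtrM // ler_wsqrtr //.
  exact: (UV1 (gram G i x, gram G i y) (conj U1x V1y)).
have h2 v : gnorm G j (g y) (v *m B') <= r * gnorm G j (g x) (v *m B).
  rewrite /gnorm /r -sqrtrM // ler_wsqrtr //.
  have QQ : quad (Q y) v <= (1 + e) * quad (Q x) v := UV2 (Q y, Q x) (conj U2y V2x) v.
  have Qx : quad (Q x) v = quad (gram G j (g x)) (v *m B) by rewrite -AxB; exact: QE.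
  have Qy : quad (Q y) v = quad (gram G j (g y)) (v *m B') by rewrite -AyB; exact: QE.
  by rewrite -Qx -Qy.
apply: norm_inv_least => [|v']; first by rewrite mulr_ge0 ?norm_inv_ge0.
rewrite -(mulmxKV Tu v'); set v := v' *m invmx T.
rewrite -TE -BE -rr.
apply: le_trans (h1 v) _; rewrite -!mulrA; apply: ler_wpM2l; first exact: sqrtr_ge0.
rewrite TE'; apply: le_trans (norm_inv_bound _ _) _; rewrite -BE' mulrCA.
apply: ler_wpM2l; first exact: norm_inv_ge0.
exact: h2.
Qed.

Lemma ln_norm_inv_diag_nbhd d : 0 < d ->
  diag_nbhd [set z | ln (Ninv z.1) <= ln (Ninv z.2) + d].
Proof.
move=> d0 p.
have e0 : 0 < expR d - 1 by rewrite subr_gt0 expR_gt1.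
have [W nW WP] := norm_inv_near p e0.
exists (W, W) => // -[x y] [/= Wx Wy].
apply: ln_le_add (norm_inv_ge0 _) (norm_inv_ge0 _) (ltW d0) _ _.
  by have := WP x y Wx Wy; rewrite addrC subrK.
by have := WP y x Wy Wx; rewrite addrC subrK.
Qed.

Lemma tangent_norm_iter (phi : M -> R) x v n :
  (forall y w, tangent_norm G y w <= expR (phi y) * tangent_norm G (g y) (w *m D y)) ->
  tangent_norm G x v <= expR (\sum_(0 <= k < n) phi (iter k g x)) *
    tangent_norm G (iter n g x) (v *m tangent_map (iter n g) x).
Proof.
have g1 := local_diffeo_C1.
elim: n => [_|n IH phiP].
  by rewrite big_geq // expR0 mul1r tangent_map_iter0 mulmx1.
have -> : \sum_(0 <= k < n.+1) phi (iter k g x) =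
    \sum_(0 <= k < n) phi (iter k g x) + phi (iter n g x).
  by move=> {IH phiP}; rewrite big_nat_recr.
apply: (le_trans (IH phiP)); rewrite expRD -mulrA (tangent_map_iterS n x g1) mulmxA.
apply: ler_wpM2l; first exact: expR_ge0.
exact: phiP.
Qed.

Lemma ln_norm_inv_bound x v :
  tangent_norm G x v <= expR (ln (Ninv x)) * tangent_norm G (g x) (v *m D x).
Proof.
apply: (le_trans (norm_inv_bound x v)).
by apply: ler_wpM2r; [exact: tangent_norm_ge0|exact: expR_ln_ge].
Qed.

End LocalDiffeo.

(** * Transport by the conjugacy and conclusion *)

Lemma conjugate_expansive (S T : topologicalType) (g : S -> S) (f : T -> T)
    (h : S -> T) (h' : T -> S) (E0 : set (T * T)) :
  continuous h -> cancel h h' -> h \o g = f \o h ->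
  closed E0 -> diag_nbhd E0 -> (forall x y, E0 (x, y) -> E0 (y, x)) ->
  (forall x y, (forall k, E0 (iter k f x, iter k f y)) -> x = y) ->
  exists E : set (S * S), [/\ closed E, diag_nbhd E,
    (forall x y, E (x, y) -> E (y, x)) &
    forall x y, (forall k, E (iter k g x, iter k g y)) -> x = y].
Proof.
move=> hc hK hgf E0cl E0n E0s E0e.
have hiter k x : h (iter k g x) = iter k f (h x).
  elim: k => [//|k IH] /=; rewrite -IH.
  exact: (congr1 (fun u => u (iter k g x)) hgf).
have hhc : continuous (fun z : S * S => (h z.1, h z.2)).
  move=> z; apply: cvg_pair => /=.
    by apply: (@continuous_comp _ _ _ fst h); [exact: cvg_fst|exact: hc].
  by apply: (@continuous_comp _ _ _ snd h); [exact: cvg_snd|exact: hc].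
exists ((fun z : S * S => (h z.1, h z.2)) @^-1` E0); split.
- exact: closed_preimage.
- by move=> x; exact: (hhc (x, x) _ (E0n (h x))).
- by move=> x y; exact: E0s.
- move=> x y Exy; apply: (can_inj hK); apply: E0e => k.
  by rewrite -!hiter; exact: Exy.
Qed.

Theorem theorem1 (R : realType) (m n : nat) (M : manifold R m)
    (N : manifold R n) (g : M -> M) (f : N -> N) (GN : riemannian_metric N) :
  compact [set: M] -> compact [set: N] ->
  local_diffeomorphism 2 g ->
  expanding GN f ->
  topologically_conjugated g f ->
  nonuniformly_expanding g (periodic_points g) ->
  forall GM : riemannian_metric M, expanding GM g.
Proof.
move=> cM cN gloc fexp [h [[hc [h' [_ hK _]]] hgf]] [_ [eta [G [eta0 Geta]]]] GM.
have g1 := local_diffeo_C1 gloc.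
split; first exact: g1.
have [E [Ecl En Es Ee]] := expanding_expansive cN fexp.
have [E' [E'cl E'n E's E'e]] := conjugate_expansive hc hK hgf Ecl En Es Ee.
pose phi x := ln (norm_inv_tangent_map G g x).
have phiper k p : (0 < k)%N -> iter k g p = p ->
    \sum_(0 <= j < k) phi (iter j g p) <= eta *+ k.
  move=> k0 kp; apply: (periodic_average_le k0).
    by move=> j /=; rewrite addnC iterD kp.
  by apply: Geta; exists k.
(* With this error the rate [eta + e] equals [eta / 2], still negative. *)
have e0 : 0 < - eta / 2 by rewrite divr_gt0 // oppr_gt0.
have [C SC] := birkhoff_sum_bound cM (local_diffeo_continuous gloc)
  (local_diffeo_open gloc) E'cl E'n E's E'e (ln_norm_inv_diag_nbhd gloc G) phiper e0.
have [C1 C10 GMG] := metric_compare GM G cM.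
have [C2 C20 GGM] := metric_compare G GM cM.
(* The adapted metric gives a loss of at most [expR C] and a rate [expR (- eta / 2)]; passing from
   [GM] to [G] costs [C1] at [x], and returning costs [C2] at the image. *)
exists (expR (- C) / (C1 * C2)), (expR (- eta / 2)); split.
- by rewrite divr_gt0 ?mulr_gt0 // expR_gt0.
- by rewrite expR_gt1.
move=> x v k.
have vw0 := @tangent_norm_iter _ _ _ g gloc G phi x v k (@ln_norm_inv_bound _ _ _ g gloc G).
set w := v *m _; rewrite -/w in vw0.
have vGM : tangent_norm GM x v <= C1 * (expR C * expR (eta / 2) ^+ k * (C2 * tangent_norm GM (iter k g x) w)).
  apply: le_trans (GMG _ _) _; apply: ler_wpM2l; first exact: ltW.
  apply: le_trans vw0 _; apply: ler_pM; rewrite ?expR_ge0 ?sqrtr_ge0 //.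
  rewrite -expRM_natl -expRD ler_expR; apply: le_trans (SC k x) _.
  by rewrite addrC lerD2l -mulr_natl; lra.
have a0 : 0 <= expR (- C) / (C1 * C2) * expR (- eta / 2) ^+ k.
  by rewrite mulr_ge0 ?exprn_ge0 ?expR_ge0 // divr_ge0 ?expR_ge0 // mulr_ge0 // ltW.
apply: le_trans (ler_wpM2l a0 vGM) _.
have -> : - eta / 2 = - (eta / 2) by lra.
rewrite !expRN exprVn.
have eC := expR_gt0 C; have ek : 0 < expR (eta / 2) ^+ k by rewrite exprn_gt0 // expR_gt0.
move: (expR C) (expR (eta / 2) ^+ k) eC ek (tangent_norm _ _ _) => a b a0' b0 t.
rewrite le_eqVlt; apply/orP; left; apply/eqP; field.
by rewrite !gt_eqF.
Qed.
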